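(* Let $T>0$. Suppose that for any $K>0$ there are kernels $\hat G^K_1,\hat G^K_2:[0,T]\to\mathcal{M}_d(\mathbb{R})$ such that, with $\hat\Delta^K_j(t)=\hat G^K_j(t)-G^K_j(t)$, there exists $\bar\Delta:[0,T]\to\mathbb{R}_+$ with $\int_0^T\bar\Delta^2(t)dt<\infty$ and $$\forall K>0,\ \forall t\in[0,T],\ \forall j\in\{1,2\},\quad \|\hat\Delta^K_j(t)\|\le\bar\Delta(t).$$ Let $X^K$ and $\hat X^K$ be the solutions on $[0,T]$ of $$X^K_t=x_0+\int_0^tG^K_1(t-s)b(X^K_s)ds+\int_0^tG^K_2(t-s)\sigma(X^K_s)dW_s,$$ $$\hat X^K_t=x_0+\int_0^t\hat G^K_1(t-s)b(\hat X^K_s)ds+\int_0^t\hat G^K_2(t-s)\sigma(\hat X^K_s)dW_s .$$ Then there is a constant $C>0$ (depending on $|x_0|$, $T$, $|b(0)|$, $\|\sigma(0)\|$, $L$, ${\bf M}_1$ and ${\bf M}_2$) such that, for all $K>0$, $$\forall t\in[0,T],\quad \mathbb{E}\big[|\hat X^K_t-X^K_t|^2\big]\le C\left(\int_0^t\Big[\|\hat\Delta^K_1(s)\|^2+\|\hat\Delta^K_2(s)\|^2\Big]ds\right) .$$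
   Context: Fix $d\ge1$, $x_0\in\mathbb{R}^d$ and a standard Brownian motion $W$ in $\mathbb{R}^d$. $\mathcal{M}_d(\mathbb{R})$ is the space of real $d\times d$ matrices, $|\cdot|$ is the Euclidean norm on $\mathbb{R}^d$ and $\|\cdot\|$ the Frobenius norm on $\mathcal{M}_d(\mathbb{R})$; $\mathbb{R}_+=[0,\infty)$. The coefficients $b:\mathbb{R}^d\to\mathbb{R}^d$ and $\sigma:\mathbb{R}^d\to\mathcal{M}_d(\mathbb{R})$ satisfy, for some $L>0$, $|b(x)-b(y)|+\|\sigma(x)-\sigma(y)\|\le L|x-y|$ for all $x,y\in\mathbb{R}^d$. $\lambda$ is a (nonnegative) measure on $\mathbb{R}_+$ such that $\bar G(t):=\int_{\mathbb{R}_+}e^{-\rho t}\lambda(d\rho)<\infty$ for all $t>0$ and $\int_0^{S}\bar G(t)^2dt<\infty$ for all $S>0$. $M_1,M_2:\mathbb{R}_+\to\mathcal{M}_d(\mathbb{R})$ are bounded measurable functions, ${\bf M}_j=\sup_{\rho\ge0}\|M_j(\rho)\|$, and the truncated kernels are $G^K_j(t)=\int_{[0,K)}e^{-\rho t}M_j(\rho)\lambda(d\rho)$ for $K>0$, $t\ge0$, $j\in\{1,2\}$. Under these assumptions the two stochastic Volterra equations have unique strong solutions on $[0,T]$ (a known result of X. Zhang).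
   Formalization: The constant C is allowed to depend also on the dominating function Δ̄ (and on the fixed d and λ), still uniformly in K; with only the listed dependence the claim fails (λ=0, d=1, b=0, σ(x)=x, x_0=1, constant kernel Ĝ_2=c). *)

(* Defs.v *)
From HB Require Import structures.
From mathcomp Require Import all_boot all_order all_algebra.
From mathcomp Require Import all_classical all_reals all_analysis.

Set Implicit Arguments.
Unset Strict Implicit.
Unset Printing Implicit Defensive.

Import Order.TTheory GRing.Theory Num.Theory.
Import numFieldNormedType.Exports.

Local Open Scope classical_set_scope.
Local Open Scope ring_scope.

(* Frobenius norm; on column vectors it is the Euclidean norm. The library's
   canonical norm on matrices is the max norm, hence this definition. *)
Definition frob (R : realType) (m n : nat) (A : 'M[R]_(m, n)) : R :=
  Num.sqrt (\sum_i \sum_j A i j ^+ 2).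

Definition lipschitz_coeffs (R : realType) (d : nat) (L : R)
    (b : 'cV[R]_d -> 'cV[R]_d) (sigma : 'cV[R]_d -> 'M[R]_d) : Prop :=
  forall x y, frob (b x - b y) + frob (sigma x - sigma y) <= L * frob (x - y).

(* A measure on [0, +oo[ is represented by a Borel measure on R all of whose
   integrals are restricted to [0, +oo[. *)
Definition Gbar (R : realType)
    (lambda : {measure set (measurableTypeR R) -> \bar R}) (t : R) : \bar R :=
  (\int[lambda]_(rho in `[0%R, +oo[) (expR (- (rho * t)))%:E)%E.

Definition bounded_measurable (R : realType) (d : nat)
    (M : R -> 'M[R]_d) : Prop :=
  (forall i j, measurable_fun (`[0, +oo[ : set (measurableTypeR R))
                              (fun rho => M rho i j)) /\
  has_ubound [set frob (M rho) | rho in `[0, +oo[].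

Definition supnorm (R : realType) (d : nat) (M : R -> 'M[R]_d) : R :=
  sup [set frob (M rho) | rho in `[0, +oo[].

Definition truncated_kernel (R : realType) (d : nat)
    (lambda : {measure set (measurableTypeR R) -> \bar R})
    (M : R -> 'M[R]_d) (K t : R) : 'M[R]_d :=
  \matrix_(i, j)
    Rintegral lambda `[0, K[ (fun rho => expR (- (rho * t)) * M rho i j).

Definition kernel_measurable (R : realType) (d : nat) (T : R)
    (G : R -> 'M[R]_d) : Prop :=
  forall i j, measurable_fun (`[0, T] : set (measurableTypeR R))
                             (fun t => G t i j).

Definition measurable_wrt (R : realType) (Omega : Type) (m n : nat)
    (F : set (set Omega)) (f : Omega -> 'M[R]_(m, n)) : Prop :=
  forall i j (B : set (measurableTypeR R)), measurable B ->
    F ((fun w => f w i j) @^-1` B).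

Definition filtration (R : realType) (dO : measure_display)
    (Omega : measurableType dO) (F : R -> set (set Omega)) : Prop :=
  [/\ forall t : R, 0 <= t -> sigma_algebra setT (F t),
      forall t : R, 0 <= t -> F t `<=` measurable
    & forall s t : R, 0 <= s -> s <= t -> F s `<=` F t].

(* The third clause says at once that W_t - W_s is independent of F_s and that
   it is N(0, (t - s) I_d)-distributed (take A = setT for the latter); the
   second parameter of normal_prob is the standard deviation. *)
Definition brownian_motion (R : realType) (dO : measure_display)
    (Omega : measurableType dO) (P : probability Omega R) (d : nat)
    (F : R -> set (set Omega)) (W : R -> Omega -> 'cV[R]_d) : Prop :=
  [/\ forall t : R, 0 <= t -> measurable_wrt (F t) (W t),
      {ae P, forall w, W 0 w = 0},
      forall s t : R, 0 <= s -> s < t ->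
        forall (A : set Omega) (B : 'I_d -> set (measurableTypeR R)),
          F s A -> (forall i, measurable (B i)) ->
          P (A `&` [set w | forall i, B i (W t w i 0 - W s w i 0)]) =
          (P A * \prod_(i < d) normal_prob 0 (Num.sqrt (t - s)) (B i))%E
    & {ae P, forall w, forall i,
        {within `[0, +oo[, continuous (fun t => W t w i 0)}}].

(* The process sum_(k < n) 1_(]tk k, tk (k+1)]) xi_k *)
Record step_process (R : realType) (Omega : Type) (d : nat) := StepProcess {
  step_size : nat ;
  step_time : nat -> R ;
  step_coef : nat -> Omega -> 'M[R]_d }.

Definition adapted_step (R : realType) (Omega : Type) (d : nat)
    (F : R -> set (set Omega)) (S : step_process R Omega d) : Prop :=
  0 <= step_time S 0 /\
  forall k, (k < step_size S)%N ->
    [/\ step_time S k <= step_time S k.+1,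
        measurable_wrt (F (step_time S k)) (step_coef S k)
      & exists B, forall w, frob (step_coef S k w) <= B].

Definition step_val (R : realType) (Omega : Type) (d : nat)
    (S : step_process R Omega d) (s : R) (w : Omega) : 'M[R]_d :=
  \sum_(k < step_size S)
    (\1_(`]step_time S k, step_time S k.+1] : set R) s) *: step_coef S k w.

Definition step_integral (R : realType) (Omega : Type) (d : nat)
    (W : R -> Omega -> 'cV[R]_d) (S : step_process R Omega d)
    (t : R) (w : Omega) : 'cV[R]_d :=
  \sum_(k < step_size S) step_coef S k w *m
    (W (Num.min (step_time S k.+1) t) w - W (Num.min (step_time S k) t) w).

(* Y is (a version of) the Ito integral of H over [0, t]: the limit in L^2(P)
   of the integrals of adapted step processes that converge to H in
   L^2(Omega x [0, t]); this forces H to be square integrable there. *)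
Definition is_ito (R : realType) (dO : measure_display)
    (Omega : measurableType dO) (P : probability Omega R) (d : nat)
    (F : R -> set (set Omega)) (W : R -> Omega -> 'cV[R]_d)
    (t : R) (H : R -> Omega -> 'M[R]_d) (Y : Omega -> 'cV[R]_d) : Prop :=
  measurable_wrt measurable Y /\
  exists S : nat -> step_process R Omega d,
    [/\ forall n, adapted_step F (S n),
        ((fun n => \int[P]_w \int[lebesgue_measure]_(s in `[0%R, t])
            (frob (H s w - step_val (S n) s w) ^+ 2)%:E) @ \oo --> 0)%E
      & ((fun n => 'E_P[(fun w => (frob (Y w - step_integral W (S n) t w) ^+ 2)%R)])
            @ \oo --> 0)%E].

(* X solves, on [0, T] and in the class of adapted measurable processes of
   L^2(Omega x [0, T]),
     X_t = x0 + int_0^t G1(t - s) b(X_s) ds + int_0^t G2(t - s) sigma(X_s) dW_s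
   almost surely, for every t in [0, T]. *)
Definition volterra_solution (R : realType) (dO : measure_display)
    (Omega : measurableType dO) (P : probability Omega R) (d : nat)
    (F : R -> set (set Omega)) (W : R -> Omega -> 'cV[R]_d) (T : R)
    (x0 : 'cV[R]_d) (b : 'cV[R]_d -> 'cV[R]_d) (sigma : 'cV[R]_d -> 'M[R]_d)
    (G1 G2 : R -> 'M[R]_d) (X : R -> Omega -> 'cV[R]_d) : Prop :=
  [/\ forall i, measurable_fun
        ((`[0, T] : set (measurableTypeR R)) `*` [set: Omega])
        (fun p : measurableTypeR R * Omega => X p.1 p.2 i 0),
      forall t : R, 0 <= t <= T -> measurable_wrt (F t) (X t),
      (\int[P]_w \int[lebesgue_measure]_(s in `[0%R, T])
         (frob (X s w) ^+ 2)%:E < +oo)%E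
    & forall t : R, 0 <= t <= T -> exists Y : Omega -> 'cV[R]_d,
        is_ito P F W t (fun s w => G2 (t - s) *m sigma (X s w)) Y /\
        {ae P, forall w, forall i,
          lebesgue_measure.-integrable `[0, t]
            (fun s => ((G1 (t - s) *m b (X s w)) i 0)%:E) /\
          X t w i 0 = x0 i 0
            + Rintegral lebesgue_measure `[0, t]
                (fun s => (G1 (t - s) *m b (X s w)) i 0)
            + Y w i 0}].

(* Main.v *)
(** A single estimate is used twice. For two solutions with kernels [(G1, G2)]
    and [(G1', G2')] on the same Brownian motion, Cauchy-Schwarz for the drift and
    the Ito isometry (up to a constant) for the martingale part bound
    E|X'_t - X_t|^2 by a multiple of the integral over s in [0, t] of
    E|G1'(t-s) b(X'_s) - G1(t-s) b(X_s)|^2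
      + E|G2'(t-s) sigma(X'_s) - G2(t-s) sigma(X_s)|^2.
    All kernels are dominated, uniformly in K, by a multiple of the integrable
    function k = Dbar^2 + Gbar^2 (in square norm), so a convolution Gronwall lemma
    with kernel k closes such an estimate with constants independent of K.
    Since the constant x0 solves the equation with zero kernels, comparing Xhat
    with it gives a bound on E|Xhat_s|^2 uniform in s and K. Then write
    Ghat g(Xhat) - G g(X) = (Ghat - G) g(Xhat) + G (g(Xhat) - g(X)) for g = b and
    g = sigma: the first term is controlled by that moment bound and by the
    kernel error, the second one is absorbed by Gronwall. *)
Require Import Defs.
From mathcomp Require Import all_boot all_order all_algebra.
From mathcomp Require Import all_classical all_reals all_analysis.
From mathcomp Require Import measurable_realfun.
From mathcomp Require Import ring lra.

Set Implicit Arguments.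
Unset Strict Implicit.
Unset Printing Implicit Defensive.

Import Order.TTheory GRing.Theory Num.Theory.
Import numFieldNormedType.Exports.

Local Open Scope classical_set_scope.
Local Open Scope ring_scope.

(** * The Frobenius norm *)

(** The constant has to be fixed before the coefficients, the kernels, the probability space and
    [K]; every auxiliary result that yields a constant therefore quantifies over functions and
    probability spaces after it. [Gbar] may blow up at 0, so [k] is integrable but possibly
    unbounded near 0, out of reach of Gronwall's lemma for bounded kernels; an exponential weight
    turns the convolution into a contraction instead. For the same reason inequalities between
    integrands are claimed for [s < t] only. The isometry is exact for step processes; for their
    limits a multiple of it suffices, so arbitrary approximating sequences can be used and the
    Gaussian second moment enters as a mere finite number. Nonnegative quantities are integrated in
    the extended reals, where Tonelli's theorem is unconditional. The finiteness that Gronwall's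
    lemma needs comes from the L^2 class in which solutions are taken. Since the equations hold
    almost surely at each fixed [t], the final bound is obtained at every [t] and not just at almost
    every one. *)

Section frobenius.
Context {R : realType}.
Implicit Types m n p : nat.

Lemma frob_ge0 m n (A : 'M[R]_(m, n)) : 0 <= frob A.
Proof. exact: sqrtr_ge0. Qed.

Lemma frob_sqr m n (A : 'M[R]_(m, n)) :
  frob A ^+ 2 = \sum_i \sum_j A i j ^+ 2.
Proof.
by rewrite sqr_sqrtr// sumr_ge0// => i _; rewrite sumr_ge0// => j _; exact: sqr_ge0.
Qed.

Lemma frob0 m n : frob (0 : 'M[R]_(m, n)) = 0.
Proof.
apply/eqP; rewrite -sqrf_eq0 frob_sqr big1// => i _.
by rewrite big1// => j _; rewrite mxE expr0n.
Qed.

Lemma frob_distC m n (A B : 'M[R]_(m, n)) : frob (A - B) = frob (B - A).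
Proof.
apply/eqP; rewrite -(@eqrXn2 _ 2)// ?frob_ge0// !frob_sqr; apply/eqP.
by apply: eq_bigr => i _; apply: eq_bigr => j _; rewrite !mxE -sqrrN opprB.
Qed.

Lemma frob_sqr_trD m n (A B : 'M[R]_(m, n)) :
  frob (A + B) ^+ 2 <= 2 * (frob A ^+ 2 + frob B ^+ 2).
Proof.
rewrite !frob_sqr -big_split/= mulr_sumr; apply: ler_sum => i _.
rewrite -big_split/= mulr_sumr; apply: ler_sum => j _.
by rewrite !mxE; have := sqr_ge0 (A i j - B i j); lra.
Qed.

Lemma frob_sqrB m n (A B : 'M[R]_(m, n)) :
  frob (A - B) ^+ 2 <= 2 * (frob A ^+ 2 + frob B ^+ 2).
Proof.
by rewrite (le_trans (frob_sqr_trD _ _))// -[- B]sub0r frob_distC subr0.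
Qed.

Lemma frob_sqr_tr3 m n (A B C : 'M[R]_(m, n)) :
  frob (A + B + C) ^+ 2 <= 3 * (frob A ^+ 2 + frob B ^+ 2 + frob C ^+ 2).
Proof.
rewrite !frob_sqr -!big_split/= mulr_sumr; apply: ler_sum => i _.
rewrite -!big_split/= mulr_sumr; apply: ler_sum => j _; rewrite !mxE.
have := sqr_ge0 (A i j - B i j); have := sqr_ge0 (A i j - C i j).
by have := sqr_ge0 (B i j - C i j); lra.
Qed.

(** The nonnegative sum of [(a y_i - c x_i)^2] equals [a (a b - c^2)]. Cancelling [a] needs the
    separate case [a = 0], where every [x_i] vanishes. *)
Lemma cauchy_schwarz_sum n (x y : 'I_n -> R) :
  (\sum_i x i * y i) ^+ 2 <= (\sum_i x i ^+ 2) * (\sum_i y i ^+ 2).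
Proof.
set a := \sum_i x i ^+ 2; set b := \sum_i y i ^+ 2; set c := \sum_i x i * y i.
have a0 : 0 <= a by apply: sumr_ge0 => i _; exact: sqr_ge0.
have [a_eq0|a_neq0] := eqVneq a 0.
  have x0 i : x i = 0.
    apply/eqP; rewrite -sqrf_eq0.
    move: a_eq0 => /psumr_eq0P -> // j _; exact: sqr_ge0.
  by rewrite /c big1 ?a_eq0 ?mul0r ?expr0n// => i _; rewrite x0 mul0r.
have : 0 <= \sum_i (a * y i - c * x i) ^+ 2.
  by apply: sumr_ge0 => i _; exact: sqr_ge0.
have -> : \sum_i (a * y i - c * x i) ^+ 2 = a * (a * b - c ^+ 2).
  rewrite (eq_bigr (fun i => a ^+ 2 * y i ^+ 2 - 2 * a * c * (x i * y i)
    + c ^+ 2 * x i ^+ 2)) => [|i _]; last by ring.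
  rewrite big_split/= sumrB -!mulr_sumr -/a -/b -/c; ring.
by rewrite pmulr_rge0 ?lt_def ?a_neq0// subr_ge0.
Qed.

(** Cauchy-Schwarz for the pairing of each row of [A] with each column of [B]; the resulting double
    sum factorizes. *)
Lemma frob_sqrM m n p (A : 'M[R]_(m, n)) (B : 'M[R]_(n, p)) :
  frob (A *m B) ^+ 2 <= frob A ^+ 2 * frob B ^+ 2.
Proof.
rewrite !frob_sqr mulr_suml; apply: ler_sum => i _.
rewrite [X in _ * X]exchange_big/= mulr_sumr; apply: ler_sum => j _.
by rewrite mxE cauchy_schwarz_sum.
Qed.

Lemma entry_frob m n (A : 'M[R]_(m, n)) i j : `|A i j| <= frob A.
Proof.
rewrite -(@ler_pXn2r _ 2)// ?nnegrE ?frob_ge0// frob_sqr real_normK ?num_real//.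
rewrite (bigD1 i)//= (bigD1 j)//= -addrA lerDl addr_ge0// sumr_ge0// => k _.
  exact: sqr_ge0.
by apply: sumr_ge0 => l _; exact: sqr_ge0.
Qed.

Lemma frob_sqr_entries m n (A : 'M[R]_(m, n)) c :
  (forall i j, `|A i j| <= c) -> frob A ^+ 2 <= (m * n)%:R * c ^+ 2.
Proof.
move=> Ac; rewrite frob_sqr.
apply: (@le_trans _ _ (\sum_(i < m) \sum_(j < n) c ^+ 2)).
  apply: ler_sum => i _; apply: ler_sum => j _.
  by rewrite -real_normK ?num_real// lerXn2r ?nnegrE// (le_trans _ (Ac i j)).
by rewrite !sumr_const !card_ord -mulrnA [(n * m)%N]mulnC mulr_natl.
Qed.

End frobenius.

(** * Lipschitz and linear growth bounds, in square norm *)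

Section lipschitz.
Context {R : realType} {d : nat} {L : R}.
Variables (b : 'cV[R]_d -> 'cV[R]_d) (sigma : 'cV[R]_d -> 'M[R]_d).
Hypotheses (lip : lipschitz_coeffs L b sigma).

Lemma lipschitz_drift x y : frob (b x - b y) <= L * frob (x - y).
Proof. by rewrite (le_trans _ (lip x y))// lerDl frob_ge0. Qed.

Lemma lipschitz_diffusion x y : frob (sigma x - sigma y) <= L * frob (x - y).
Proof. by rewrite (le_trans _ (lip x y))// lerDr frob_ge0. Qed.

End lipschitz.

(** Matrices of any format are allowed as values, so that the drift (one column) and the diffusion
    coefficient are treated alike. *)
Lemma lipschitz_sqr (R : realType) (d m n : nat) (L : R)
    (g : 'cV[R]_d -> 'M[R]_(m, n)) x y :
  frob (g x - g y) <= L * frob (x - y) ->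
  frob (g x - g y) ^+ 2 <= L ^+ 2 * frob (x - y) ^+ 2.
Proof.
by move=> gL; rewrite -exprMn lerXn2r ?nnegrE ?frob_ge0// (le_trans _ gL) ?frob_ge0.
Qed.

Lemma linear_growth_sqr (R : realType) (d m n : nat) (L : R)
    (g : 'cV[R]_d -> 'M[R]_(m, n)) (x : 'cV[R]_d) :
  frob (g x - g 0) <= L * frob (x - 0) ->
  frob (g x) ^+ 2 <= 2 * (frob (g 0) ^+ 2 + L ^+ 2 * frob x ^+ 2).
Proof.
move=> /lipschitz_sqr; rewrite subr0 => gL.
by rewrite -[g x](subrK (g 0)) (le_trans (frob_sqr_trD _ _))// ler_wpM2l// addrC lerD2l.
Qed.

(** * Measurability of matrix-valued functions *)

Section measurable_matrix.
Context {R : realType} {dT : measure_display} {T : measurableType dT}.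
Implicit Types (D : set T) (m n p : nat).

Definition measurable_mx D m n (f : T -> 'M[R]_(m, n)) :=
  forall i j, measurable_fun D (fun x => f x i j).

Lemma measurable_mx_cst D m n (A : 'M[R]_(m, n)) : measurable_mx D (fun=> A).
Proof. by move=> i j; exact: measurable_cst. Qed.

Lemma measurable_mxB D m n (f g : T -> 'M[R]_(m, n)) :
  measurable_mx D f -> measurable_mx D g -> measurable_mx D (fun x => f x - g x).
Proof.
move=> mf mg i j; under eq_fun do rewrite !mxE.
exact: measurable_funB.
Qed.

Lemma measurable_mxM D m n p (f : T -> 'M[R]_(m, n)) (g : T -> 'M[R]_(n, p)) :
  measurable_mx D f -> measurable_mx D g ->
  measurable_mx D (fun x => f x *m g x).
Proof.
move=> mf mg i j; under eq_fun do rewrite mxE.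
by apply: measurable_sum => k; exact: measurable_funM.
Qed.

Lemma measurable_mxZ D m n (f : T -> R) (g : T -> 'M[R]_(m, n)) :
  measurable_fun D f -> measurable_mx D g ->
  measurable_mx D (fun x => f x *: g x).
Proof.
move=> mf mg i j; under eq_fun do rewrite mxE.
exact: measurable_funM.
Qed.

Lemma measurable_mx_sum D m n (I : Type) (s : seq I) (f : I -> T -> 'M[R]_(m, n)) :
  (forall i, measurable_mx D (f i)) -> measurable_mx D (fun x => \sum_(i <- s) f i x).
Proof.
move=> mf i j; under eq_fun do rewrite summxE.
by apply: measurable_sum => k; exact: mf.
Qed.

Lemma measurable_frob_sqr D m n (f : T -> 'M[R]_(m, n)) :
  measurable_mx D f -> measurable_fun D (fun x => frob (f x) ^+ 2).
Proof.
move=> mf; under eq_fun do rewrite frob_sqr.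
apply: measurable_sum => i; apply: measurable_sum => j.
exact: measurable_funX.
Qed.

Lemma measurable_frob D m n (f : T -> 'M[R]_(m, n)) :
  measurable_mx D f -> measurable_fun D (fun x => frob (f x)).
Proof.
(* The square root is written as the power 1/2, and powers are measurable. *)
move=> mf; have -> : (fun x => frob (f x)) =
    (fun x => (frob (f x) ^+ 2) `^ 2^-1).
  by apply/funext => x; rewrite powR12_sqrt ?sqr_ge0// sqrtr_sqr ger0_norm ?frob_ge0.
apply: (@measurableT_comp _ _ _ _ _ _ (@powR R ^~ 2^-1)) => //.
exact: measurable_frob_sqr.
Qed.

Lemma measurable_mxS D E m n (f : T -> 'M[R]_(m, n)) :
  measurable D -> E `<=` D -> measurable_mx D f -> measurable_mx E f.
Proof. by move=> mD ED mf i j; exact: measurable_funS (mf i j). Qed.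

(* A Lipschitz function is the infimum of [q |-> g q + L |x - q|] over any dense
   set, here the rational vectors, so its sublevel sets are countable unions. *)
Lemma measurable_lipschitz_comp D d (L : R) (g : 'cV[R]_d -> R)
    (f : T -> 'cV[R]_d) : measurable D ->
  (forall x y, `|g x - g y| <= L * frob (x - y)) ->
  measurable_mx D f -> measurable_fun D (g \o f).
Proof.
move=> mD gL mf.
(* For [L <= 0] the hypothesis forces [g] to be constant; below, [L] is divided by. *)
have [L_le0|L_gt0] := leP L 0.
  have gcst x : g x = g 0.
    apply/eqP; rewrite -subr_eq0 -normr_le0 (le_trans (gL _ _))//.
    by rewrite mulr_le0_ge0// frob_ge0.
  by rewrite (_ : g \o f = cst (g 0)); [exact: measurable_cst|apply/funext=> x; exact: gcst].
pose q (z : {ffun 'I_d -> rat}) : 'cV[R]_d := \col_i ratr (z i).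
apply: (measurability (@RGenInftyO.G R)); first exact: RGenInftyO.measurableE.
move=> /= _ [_ [a ->] <-].
rewrite (_ : _ `&` _ = \bigcup_(z : {ffun 'I_d -> rat})
  (D `&` (fun x => g (q z) + L * frob (f x - q z)) @^-1` `]-oo, a[)); last first.
  rewrite -setI_bigcupr; congr (_ `&` _); apply/seteqP; split=> x /=.
    rewrite in_itv/= => gxa.
    (* A point [y] within [e] of [f x] satisfies [g y + L |f x - y| <= g (f x) + 2 L |f x - y| < a].
       Coordinates within [c = e / (d + 1)] are enough, because [d c^2 < ((d + 1) c)^2 = e^2],
       strictly even for [d = 0]. *)
    pose e := (a - g (f x)) / (2 * L).
    pose c := e / (d.+1)%:R.
    have e_gt0 : 0 < e by rewrite divr_gt0 ?subr_gt0// mulr_gt0.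
    have c_gt0 : 0 < c by rewrite divr_gt0.
    have z_ i : {r : rat | `|f x i 0 - ratr r| < c}.
      apply: cid; have := @rat_in_itvoo R (f x i 0 - c) (f x i 0 + c).
      case=> [|r]; first lra.
      by rewrite in_itv/= => /andP[? ?]; exists r; rewrite ltr_norml; lra.
    exists [ffun i => sval (z_ i)] => //=; rewrite in_itv/=.
    set y := q _.
    have fxy : frob (f x - y) < e.
      rewrite -(@ltr_pXn2r _ 2)// ?nnegrE ?frob_ge0 ?(ltW e_gt0)//.
      apply: (@le_lt_trans _ _ ((d * 1)%:R * c ^+ 2)).
        apply: frob_sqr_entries => i j; rewrite !mxE ffunE (ord1 j).
        by apply: ltW; exact: svalP (z_ i).
      have -> : e = d.+1%:R * c by rewrite mulrC divfK.
      rewrite [ltRHS]exprMn ltr_pM2r ?exprn_gt0// muln1 -natrX ltr_nat.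
      by rewrite (leq_trans (ltnSn d))// leq_pmulr.
    have := gL y (f x); rewrite frob_distC => /(le_trans (ler_norm _)).
    have /(lt_trans _) : L * frob (f x - y) < L * e by rewrite ltr_pM2l.
    have : L * e * 2 = a - g (f x) by rewrite /e; field; lra.
    move=> He _ H.
    have : L * frob (f x - y) < L * e by rewrite ltr_pM2l.
    lra.
  move=> [z _]; rewrite !in_itv/= => H; apply: le_lt_trans H.
  by have := gL (f x) (q z) => /(le_trans (ler_norm _)); lra.
apply: countable_bigcupT_measurable => [|z]; first exact: countableP.
suff mh : measurable_fun D (fun x => g (q z) + L * frob (f x - q z)).
  by apply: mh => //; exact: measurable_itv.
apply: measurable_funD => //; apply: measurable_funM => //.
by apply: measurable_frob; apply: measurable_mxB => //; exact: measurable_mx_cst.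
Qed.

Lemma measurable_mx_lipschitz_comp D d m n (L : R)
    (g : 'cV[R]_d -> 'M[R]_(m, n)) (f : T -> 'cV[R]_d) : measurable D ->
  (forall x y, frob (g x - g y) <= L * frob (x - y)) ->
  measurable_mx D f -> measurable_mx D (fun x => g (f x)).
Proof.
move=> mD gL mf i j; apply: (@measurable_lipschitz_comp _ _ L (fun y => g y i j)) => //.
move=> x y; apply: le_trans (gL x y).
by have := entry_frob (g x - g y) i j; rewrite !mxE.
Qed.

End measurable_matrix.

(** * Convolution form of Gronwall's inequality *)

Section lebesgue_reflection.
Local Open Scope ereal_scope.
Context {R : realType}.
Local Notation mu := (@lebesgue_measure R).

(** Lebesgue measure is determined by its values on the intervals []a, b]], and the reflection pulls
    such an interval back to [[t - b, t - a[], of the same length. *)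
Lemma integral_reflect (t : R) (f : R -> \bar R) :
  measurable_fun [set: measurableTypeR R] f -> (forall s, 0 <= f s) ->
  \int[mu]_s f (t - s)%R = \int[mu]_s f s.
Proof.
move=> mf f0.
pose phi : measurableTypeR R -> measurableTypeR R := fun s => (t - s)%R.
have mphi : measurable_fun setT phi by exact: measurable_funB.
transitivity (\int[pushforward mu phi]_s f s).
  by rewrite ge0_integral_pushforward// preimage_setT.
apply: eq_measure_integral => /= A mA _; apply/esym.
apply: (@lebesgue_measure_unique R (pushforward mu phi)) => //= _ [[a b]] _ <-.
rewrite /pushforward (_ : phi @^-1` _ = `[(t - b)%R, (t - a)%R[%classic).
  rewrite !lebesgue_measure_itv/= !lte_fin ltrD2l ltrN2; case: ifPn => // _.
  by rewrite -!EFinB; congr EFin; lra.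
by apply/seteqP; split=> s /=; rewrite !in_itv/= /phi => /andP[? ?];
  apply/andP; split; lra.
Qed.

(** A translation is the composite of two reflections. *)
Lemma integral_translate (t : R) (f : R -> \bar R) :
  measurable_fun [set: measurableTypeR R] f -> (forall s, 0 <= f s) ->
  \int[mu]_s f (s - t)%R = \int[mu]_s f s.
Proof.
move=> mf f0; rewrite -(integral_reflect 0 mf f0).
rewrite -(@integral_reflect t (fun s => f (0 - s)%R))//.
  by apply: eq_integral => s _; rewrite sub0r opprB.
by apply: measurableT_comp => //; exact: measurable_funB.
Qed.

End lebesgue_reflection.

(** * Cauchy-Schwarz against the constant 1 on a set of finite measure *)

Section cauchy_schwarz.
Local Open Scope ereal_scope.
Context {R : realType} {dT : measure_display} {T : measurableType dT}.
Variable mu : {measure set T -> \bar R}.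

(* AM-GM: [2 e |h| <= e^2 + h^2] with [e = a / m], where [a] is the absolute
   value of the integral. *)
Lemma Rintegral_sqr_le (D : set T) (h : T -> R) (m : R) : measurable D ->
  (0 < m)%R -> mu D <= m%:E -> mu.-integrable D (EFin \o h) ->
  ((Rintegral mu D h) ^+ 2)%:E <= m%:E * \int[mu]_(x in D) (h x ^+ 2)%:E.
Proof.
move=> mD m0 muD ih; set I := Rintegral mu D h; set J := \int[mu]_(x in D) _.
have mh : measurable_fun D h by apply/measurable_EFinP; exact: measurable_int ih.
have mh2 : measurable_fun D (fun x => (h x ^+ 2)%:E).
  by apply/measurable_EFinP; exact: measurable_funX.
have J0 : 0 <= J by apply: integral_ge0 => x _; rewrite lee_fin sqr_ge0.
have [->|I0] := eqVneq I 0%R; first by rewrite expr0n/= mule_ge0// lee_fin ltW.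
have a0 : (0 < `|I|)%R by rewrite normr_gt0.
pose e := (`|I| / m)%R; have e0 : (0 < e)%R by rewrite divr_gt0.
have : (2 * e * `|I|)%:E <= (e ^+ 2 * m)%:E + J.
  apply: (@le_trans _ _ (\int[mu]_(x in D) ((2 * e)%:E * `|(h x)%:E|))).
    rewrite ge0_integralZl//; last 2 first.
      by apply: measurableT_comp => //; apply/measurable_EFinP.
      by rewrite lee_fin mulr_ge0// ltW.
    rewrite EFinM lee_wpmul2l ?lee_fin ?mulr_ge0 ?invr_ge0 ?(ltW m0)//.
    rewrite /I EFin_normr_Rintegral//; exact: le_abse_integral (measurable_int _ ih).
  apply: (@le_trans _ _ (\int[mu]_(x in D) ((e ^+ 2)%:E + (h x ^+ 2)%:E))).
    apply: ge0_le_integral => //.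
    - by move=> x _; rewrite mule_ge0// lee_fin mulr_ge0// ltW.
    - by apply: measurable_funeM; apply: measurableT_comp => //; apply/measurable_EFinP.
    - by apply: emeasurable_funD.
    - move=> x _; rewrite -EFinD /= -EFinM lee_fin.
      by have := sqr_ge0 (e - `|h x|)%R; rewrite -(real_normK (num_real (h x))); lra.
  rewrite ge0_integralD//; last 2 first.
    by move=> x _; rewrite lee_fin sqr_ge0.
    by move=> x _; rewrite lee_fin sqr_ge0.
  rewrite leeD2r// (integral_cst _ mD (e ^+ 2)%:E) [leRHS]EFinM.
  by rewrite lee_wpmul2l// lee_fin sqr_ge0.
have [->|Jfin] := eqVneq J +oo; first by move=> _; rewrite gt0_muley ?lte_fin// leey.
have -> : J = (fine J)%:E by rewrite fineK// ge0_fin_numE// ltey.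
rewrite -EFinD -EFinM !lee_fin -(real_normK (num_real I)).
have -> : (`|I| = e * m)%R by rewrite /e divfK// gt_eqF.
move=> H; have : (e * e * m <= fine J)%R by lra.
by rewrite -(ler_pM2l m0); lra.
Qed.

End cauchy_schwarz.

(** * Gronwall's lemma for an integrable kernel on the half-line *)

Section gronwall.
Local Open Scope ereal_scope.
Context {R : realType}.
Local Notation mu := (@lebesgue_measure R).
Variable k : R -> R.
Hypotheses (k_ge0 : forall s, (0 <= k s)%R)
  (k_supp : forall s, (s <= 0)%R -> k s = 0%R)
  (k_int : mu.-integrable [set: measurableTypeR R] (EFin \o k)).

Let mk : measurable_fun [set: measurableTypeR R] k.
Proof. by apply/measurable_EFinP; exact: measurable_int k_int. Qed.

(** What [k] becomes when the convolution inequality at time [t] is multiplied by [e^(-n t)]. *)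
Let damped n s := (expR (- (n%:R * s)) * k s)%R.

Let damped_ge0 n s : (0 <= damped n s)%R.
Proof. by rewrite mulr_ge0// expR_ge0. Qed.

Let mdamped n : measurable_fun [set: measurableTypeR R] (damped n).
Proof.
apply: measurable_funM => //; apply: measurableT_comp => //.
by apply: measurableT_comp => //; exact: measurable_funM.
Qed.

(** Dominated convergence, with [k] as the dominating function: the weight tends to 0 at every
    [s > 0], and [k] vanishes elsewhere, including at 0, where the weight stays equal to 1. *)
Lemma exponential_damping :
  exists n : nat, \int[mu]_s (damped n s)%:E <= (2^-1)%:E.
Proof.
suff : (fun n => \int[mu]_s (damped n s)%:E) @ \oo --> (0 : \bar R).
  move=> cu; have : \forall n \near \oo, \int[mu]_s (damped n s)%:E < (2^-1)%:E.
    apply: (cu [set u | u < (2^-1)%:E]).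
    by apply: open_ereal_lt'; rewrite lte_fin invr_gt0.
  by case=> N _ /(_ N (leqnn N)) /ltW; exists N.
have := @dominated_cvg _ _ _ mu setT measurableT (fun n s => (damped n s)%:E)
  (cst 0) (EFin \o k).
rewrite integral0; apply => //.
- by move=> n; apply/measurable_EFinP; exact: mdamped.
- move=> s _; apply/cvg_EFin; first by near=> n.
  have [s_le0|s_gt0] := leP s 0%R.
    rewrite (_ : _ \o _ = cst 0%R); first exact: cvg_cst.
    by apply/funext => n /=; rewrite /damped k_supp// mulr0.
  rewrite (_ : _ \o _ = (fun n => expR (- s) ^+ n * k s)%R); last first.
    by apply/funext => n /=; rewrite /damped -mulrN -expRM_natl.
  rewrite -[X in _ --> X](mul0r (k s)); apply: cvgMr_tmp.
  by apply: cvg_expr; rewrite ger0_norm ?expR_ge0// -expR0 ltr_expR oppr_lt0.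
- move=> n s _; rewrite /= lee_fin /damped ger0_norm ?damped_ge0//.
  have [s_le0|s_gt0] := leP s 0%R; first by rewrite k_supp// mulr0.
  by rewrite ler_piMl// -expR0 ler_expR oppr_le0 mulr_ge0// ltW.
Unshelve. all: by end_near. Qed.

(* The weight [e^(-n s)] makes the kernel a strict contraction on L^1, and
   [h := max (g - 2A, 0)], with [g] the weighted [f], satisfies [h <= damped * h]
   (a convolution): thus [h] vanishes almost everywhere, and then everywhere. *)
Lemma convolution_gronwall (T : R) : exists C : R, (0 < C)%R /\
  forall (f : R -> \bar R) (A t0 : R), measurable_fun [set: measurableTypeR R] f ->
  (forall t, 0 <= f t) -> (0 <= t0 <= T)%R -> (0 <= A)%R ->
  \int[mu]_(s in `[0%R, t0]) f s < +oo ->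
  (forall t, (0 <= t <= t0)%R ->
     f t <= A%:E + \int[mu]_(s in `[0%R, t]) ((k (t - s))%:E * f s)) ->
  forall t, (0 <= t <= t0)%R -> f t <= (C * A)%:E.
Proof.
have [n n_half] := exponential_damping.
(* The weighted function will be at most [2 A], and [e^(n T)] undoes the weight on [[0, T]]; [n]
   depends on [k] alone. *)
exists (2 * expR (n%:R * T))%R; split; first by rewrite mulr_gt0// expR_gt0.
move=> f A t0 mf f_ge0 /andP[t0_ge0 t0T] A_ge0 f_int f_le.
pose I0 := `[0%R, t0]%classic : set (measurableTypeR R).
pose w (s : R) : R := expR (- (n%:R * s)).
have w_ge0 s : (0 <= w s)%R by exact: expR_ge0.
have mw : measurable_fun [set: measurableTypeR R] w.
  apply: measurableT_comp => //.
  by apply: measurableT_comp => //; exact: measurable_funM.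
pose g s := (w s)%:E * (f \_ I0) s.
have fI0_ge0 s : 0 <= (f \_ I0) s by apply: erestrict_ge0 => ? _.
have g_ge0 s : 0 <= g s by rewrite mule_ge0// lee_fin.
have mI0 : measurable I0 by exact: measurable_itv.
have mfI0 : measurable_fun setT (f \_ I0).
  by apply/(measurable_restrictT _ mI0); exact: measurable_funTS.
have mg : measurable_fun [set: measurableTypeR R] g.
  by apply: emeasurable_funM => //; exact/measurable_EFinP.
(* The level [2 A] is a fixed point: [A] is the inhomogeneous term, and the damped kernel, of mass
   at most 1/2, sends the constant [2 A] below [A]. *)
pose h s := maxe (g s - (2 * A)%:E) 0.
have h_ge0 s : 0 <= h s by rewrite /h le_max lexx orbT.
have mh : measurable_fun [set: measurableTypeR R] h.
  by apply: measurable_maxe => //; exact: emeasurable_funB.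
have g_le s : g s <= (2 * A)%:E + h s.
  rewrite addeC -leeBlDr// /h le_max lexx//.
have h_le s : h s <= g s.
  by rewrite /h ge_max g_ge0 andbT leeBlDr// leeDl// lee_fin mulr_ge0.
have mconv (u : R -> \bar R) : measurable_fun [set: measurableTypeR R] u ->
    measurable_fun setT (fun p : measurableTypeR R * measurableTypeR R =>
      (damped n (p.1 - p.2))%:E * u p.2).
  move=> mu_; apply: emeasurable_funM; last first.
    by apply: measurableT_comp => //; exact: measurable_snd.
  apply/measurable_EFinP; apply: measurableT_comp; first exact: mdamped.
  by apply: measurable_funB; [exact: measurable_fst|exact: measurable_snd].
have mconv1 (u : R -> \bar R) t : measurable_fun [set: measurableTypeR R] u ->
    measurable_fun setT (fun s : measurableTypeR R => (damped n (t - s))%:E * u s).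
  move=> mu_; apply: emeasurable_funM => //.
  apply/measurable_EFinP; apply: measurableT_comp; first exact: mdamped.
  exact: measurable_funB.
have mdampedr t : measurable_fun [set: measurableTypeR R] (fun s => (damped n (t - s))%:E).
  apply/measurable_EFinP; apply: measurableT_comp; first exact: mdamped.
  exact: measurable_funB.
have mdampedl s : measurable_fun [set: measurableTypeR R] (fun t => (damped n (t - s))%:E).
  apply/measurable_EFinP; apply: measurableT_comp; first exact: mdamped.
  exact: measurable_funB.
have mkr t : measurable_fun [set: measurableTypeR R] (fun s => (k (t - s))%:E).
  apply/measurable_EFinP; apply: measurableT_comp; first exact: mk.
  exact: measurable_funB.
have mwkf t : measurable_fun [set: measurableTypeR R]
    (fun s => (w t)%:E * ((k (t - s))%:E * f s)).
  by apply: measurable_funeM; exact: emeasurable_funM.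
have h_conv t : h t <= \int[mu]_s ((damped n (t - s))%:E * h s).
  have conv_ge0 : 0 <= \int[mu]_s ((damped n (t - s))%:E * h s).
    by apply: integral_ge0 => s _; rewrite mule_ge0// lee_fin.
  have [tI0|tNI0] := boolP (t \in I0); last first.
    rewrite {1}/h ge_max conv_ge0 andbT /g patchE (negbTE tNI0) mule0 add0e.
    by rewrite (le_trans _ conv_ge0)// leeNl oppe0 lee_fin mulr_ge0.
  have /andP[t_ge0 tt0] : (0 <= t <= t0)%R by move: tI0; rewrite inE /I0/= in_itv.
  rewrite {1}/h ge_max conv_ge0 andbT leeBlDr//.
  apply: (@le_trans _ _ (A%:E + \int[mu]_s ((damped n (t - s))%:E * g s))).
    rewrite /g patchE tI0.
    apply: (@le_trans _ _ ((w t)%:E *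
        (A%:E + \int[mu]_(s in `[0%R, t]) ((k (t - s))%:E * f s)))).
      by rewrite lee_wpmul2l ?lee_fin// f_le// t_ge0.
    rewrite ge0_muleDr ?lee_fin//; last first.
      by apply: integral_ge0 => s _; rewrite mule_ge0// lee_fin.
    apply: leeD.
      rewrite -EFinM lee_fin ler_piMl// -expR0 ler_expR oppr_le0 mulr_ge0//.
    rewrite -ge0_integralZl//; last 3 first.
    - apply: measurable_funTS; exact: emeasurable_funM.
    - by move=> s _; rewrite mule_ge0// lee_fin.
    - by rewrite lee_fin.
    rewrite integral_mkcond; apply: ge0_le_integral => //.
    - by move=> s _; apply: erestrict_ge0 => r _; rewrite !mule_ge0// lee_fin.
    - apply/(measurable_restrictT _ (measurable_itv _)); apply: measurable_funTS.
      exact: mwkf.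
    - exact: mconv1.
    - move=> s _; rewrite patchE; case: ifPn => [|_]; last first.
        by rewrite mule_ge0// ?lee_fin// -/(g s).
      rewrite inE/= in_itv/= => /andP[s_ge0 st].
      rewrite /g patchE ifT; last first.
        by rewrite inE /I0/= in_itv/= s_ge0 (le_trans st).
      (* The weight is multiplicative, [w t = w (t - s) w s]: one factor damps the kernel, the other
         one weights [f]. *)
      rewrite !muleA -!EFinM /damped mulrAC -expRD.
      by rewrite (_ : - _ + _ = - (n%:R * t))%R//; ring.
  apply: (@le_trans _ _ (A%:E + (A%:E + \int[mu]_s ((damped n (t - s))%:E * h s)))).
    rewrite leeD2l//.
    apply: (@le_trans _ _ (\int[mu]_s ((2 * A)%:E * (damped n (t - s))%:E +
       (damped n (t - s))%:E * h s))).
      apply: ge0_le_integral => //.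
      - by move=> s _; rewrite mule_ge0// lee_fin.
      - exact: mconv1.
      - apply: emeasurable_funD; last exact: mconv1.
        exact: measurable_funeM.
      - move=> s _; rewrite muleC [X in _ <= _ + X]muleC.
        rewrite -ge0_muleDl ?lee_fin ?mulr_ge0//.
        by rewrite lee_wpmul2r// lee_fin.
    rewrite ge0_integralD//; last 4 first.
    - by move=> s _; rewrite mule_ge0// lee_fin// mulr_ge0.
    - exact: measurable_funeM.
    - by move=> s _; rewrite mule_ge0// lee_fin.
    - exact: mconv1.
    rewrite leeD2r// ge0_integralZl//; last 2 first.
    - by move=> s _; rewrite lee_fin.
    - by rewrite lee_fin mulr_ge0.
    rewrite (@integral_reflect R t (fun s => (damped n s)%:E))//; last first.
    - by move=> s; rewrite lee_fin.
    - by apply/measurable_EFinP; exact: mdamped.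
    apply: (@le_trans _ _ ((2 * A)%:E * (2^-1)%:E)).
      by rewrite lee_wpmul2l// lee_fin mulr_ge0.
    by rewrite -EFinM lee_fin; lra.
  by rewrite addeA -EFinD addeC leeD2l// lee_fin; lra.
pose H := \int[mu]_s h s.
have H_ge0 : 0 <= H by exact: integral_ge0.
have H_fin : H < +oo.
  apply: le_lt_trans f_int; rewrite integral_mkcond; apply: ge0_le_integral => //.
  move=> s _; apply: (le_trans (h_le s)); rewrite /g.
  rewrite patchE; case: ifPn => [|_]; last by rewrite mule0.
  rewrite inE /I0/= in_itv/= => /andP[s_ge0 _].
  by rewrite gee_pMl// lee_fin -expR0 ler_expR oppr_le0 mulr_ge0.
(* By Tonelli and translation invariance, integrating [h_conv] over [t] brings out the mass of the
   damped kernel, hence [H <= H / 2]; the finiteness of [H] then leaves only 0. *)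
have H0 : H = 0.
  have : H <= (2^-1)%:E * H.
    apply: (@le_trans _ _ (\int[mu]_t \int[mu]_s ((damped n (t - s))%:E * h s))).
      apply: ge0_le_integral => //.
      have := measurable_fun_fubini_tonelli_F (m2 := mu) _ (mconv _ mh).
      by apply => p; rewrite mule_ge0// lee_fin.
    rewrite (@fubini_tonelli _ _ _ _ R mu mu (fun p => (damped n (p.1 - p.2))%:E * h p.2)
      (mconv _ mh)) /=; last by move=> p; rewrite mule_ge0// lee_fin.
    rewrite -ge0_integralZl//.
    apply: ge0_le_integral => //.
    - by move=> s _; apply: integral_ge0 => t _; rewrite mule_ge0// lee_fin.
    - have := measurable_fun_fubini_tonelli_G (m1 := mu) _ (mconv _ mh).
      by apply => p; rewrite mule_ge0// lee_fin.
    - by apply: measurable_funeM.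
    - move=> s _; rewrite ge0_integralZr//; last by move=> t _; rewrite lee_fin.
      rewrite lee_wpmul2r//; apply: le_trans n_half.
      rewrite (@integral_translate R s (fun t => (damped n t)%:E))//.
        by apply/measurable_EFinP; exact: mdamped.
      by move=> t; rewrite lee_fin.
  have : H = (fine H)%:E by rewrite fineK// ge0_fin_numE.
  move=> ->; rewrite -EFinM lee_fin => Hle; congr EFin.
  have : (0 <= fine H)%R by exact: fine_ge0.
  by move: Hle; lra.
(* The integral in [h_conv] ignores null sets, so the almost everywhere statement upgrades to every
   point. *)
have h0 s : h s = 0.
  apply/eqP; rewrite eq_le h_ge0 andbT; apply: (le_trans (h_conv s)).
  rewrite (ae_eq_integral (cst 0)) ?integral0//.
  - exact: mconv1.
  - have : ae_eq mu setT h (cst 0).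
      apply/(ae_eq_integral_abs mu measurableT mh).
      by under eq_integral do rewrite gee0_abs//.
    by apply: filterS => r /= -> //; rewrite mule0.
move=> t tt0; have := g_le t; rewrite h0 adde0 /g patchE ifT; last first.
  by rewrite inE /I0/= in_itv.
rewrite -lee_pdivlMl ?expR_gt0// => /le_trans; apply.
rewrite -EFinM lee_fin /w -expRN opprK mulrCA mulrA ler_wpM2r// ler_wpM2l//.
by rewrite ler_expR ler_wpM2l//; lra.
Qed.

End gronwall.

(** * Gaussian increments *)

Section normal_moments.
Local Open Scope ereal_scope.
Context {R : realType}.
Local Notation mu := (@lebesgue_measure R).

(** The change of variables is by the Radon-Nikodym derivative, which agrees almost everywhere with
    the explicit density because both have the same integral over every measurable set. *)
Lemma ge0_integral_normal_prob (m s : R) (f : R -> \bar R) :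
  measurable_fun [set: measurableTypeR R] f -> (forall x, 0 <= f x) ->
  \int[normal_prob m s]_x f x = \int[mu]_x (f x * (normal_pdf m s x)%:E).
Proof.
move=> mf f0; have dom := normal_prob_dominates m s.
rewrite -(Radon_Nikodym_SigmaFinite.change_of_variables dom)//.
have mpdf : measurable_fun [set: measurableTypeR R] (fun x => (normal_pdf m s x)%:E).
  by apply/measurable_EFinP; exact: measurable_normal_pdf.
have iRN := Radon_Nikodym_SigmaFinite.f_integrable dom.
have mRN := measurable_int _ iRN.
apply: ge0_ae_eq_integral => //.
- exact: emeasurable_funM.
- exact: emeasurable_funM.
- by move=> x _; rewrite mule_ge0// Radon_Nikodym_SigmaFinite.f_ge0.
- by move=> x _; rewrite mule_ge0// lee_fin normal_pdf_ge0.
apply: ae_eqe_mul2l; apply: integral_ae_eq => //.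
by move=> E _ mE; rewrite -Radon_Nikodym_SigmaFinite.f_integral.
Qed.

Lemma normal_pdfN (s x : R) : normal_pdf 0 s (- x)%R = normal_pdf 0 s x \/ s = 0%R.
Proof.
have [->|s0] := eqVneq s 0%R; [by right|left].
by rewrite !normal_pdfE// /normal_fun !subr0 sqrrN.
Qed.

Lemma integral_normal_probN (s : R) (f : R -> \bar R) : s != 0%R ->
  measurable_fun [set: measurableTypeR R] f -> (forall x, 0 <= f x) ->
  \int[normal_prob 0 s]_x f (- x)%R = \int[normal_prob 0 s]_x f x.
Proof.
move=> s0 mf f0; rewrite !ge0_integral_normal_prob//; last first.
  by apply: measurableT_comp => //; exact: measurable_funN.
pose g x := f x * (normal_pdf 0 s x)%:E.
rewrite [RHS](_ : _ = \int[mu]_x g (0 - x)%R).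
  apply: eq_integral => x _; rewrite /g sub0r.
  by case: (normal_pdfN s x) => [->//|/eqP]; rewrite (negbTE s0).
rewrite integral_reflect//; last by move=> x; rewrite mule_ge0// lee_fin normal_pdf_ge0.
apply: emeasurable_funM => //; apply/measurable_EFinP.
exact: measurable_normal_pdf.
Qed.

(* Its value is 1, but only its finiteness matters. *)
Definition gaussian_second_moment : R :=
  fine (\int[normal_prob 0 1]_x (x ^+ 2)%:E).

Lemma gaussian_second_moment_ge0 : (0 <= gaussian_second_moment)%R.
Proof. by apply/fine_ge0/integral_ge0 => x _; rewrite lee_fin sqr_ge0. Qed.

Let m_sqr : measurable_fun [set: measurableTypeR R] (fun x : R => (x ^+ 2)%:E).
Proof. by apply/measurable_EFinP; exact: exprn_measurable. Qed.

Let sqr_ge0e (x : R) : 0 <= (x ^+ 2)%:E.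
Proof. by rewrite lee_fin sqr_ge0. Qed.

(* [x^2 <= 4 e^(x^2/4)] bounds the integrand by a multiple of another Gaussian
   density. *)
Lemma gaussian_second_momentE :
  \int[normal_prob 0 1]_x (x ^+ 2)%:E = gaussian_second_moment%:E.
Proof.
rewrite fineK// ge0_fin_numE; last exact: integral_ge0.
rewrite ge0_integral_normal_prob//.
(* Half of the exponent, [e^(-x^2/4)], absorbs [x^2] at the price of a factor 4; the other half is
   the unnormalized density of variance 2. The quotient of peaks in [C] exchanges the
   normalizations. *)
pose s := Num.sqrt (2 : R).
have s_gt0 : (0 < s)%R by rewrite sqrtr_gt0.
have s2 : (s ^+ 2 = 2)%R by rewrite sqr_sqrtr.
pose C := (4 * (normal_peak 1 / normal_peak s))%R.
have C_ge0 : (0 <= C)%R by rewrite !mulr_ge0// ?invr_ge0 ?normal_peak_ge0.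
apply: (@le_lt_trans _ _ (\int[mu]_x (C%:E * (normal_pdf 0 s x)%:E))).
  apply: ge0_le_integral => //.
  - by move=> x _; rewrite mule_ge0// lee_fin normal_pdf_ge0.
  - apply: emeasurable_funM => //; apply/measurable_EFinP.
    exact: measurable_normal_pdf.
  - apply: measurable_funeM; apply/measurable_EFinP.
    exact: measurable_normal_pdf.
  - move=> x _; rewrite -!EFinM lee_fin !normal_pdfE ?oner_eq0 ?gt_eqF//.
    rewrite /C /normal_fun !subr0 s2 expr1n.
    rewrite [leRHS](_ : _ = normal_peak 1 * (4 * expR (- x ^+ 2 / (2 *+ 2))))%R; last first.
      by field; rewrite gt_eqF// normal_peak_gt0// gt_eqF.
    rewrite mulrCA ler_wpM2l ?normal_peak_ge0//.
    rewrite (_ : - x ^+ 2 / (1 *+ 2) = - x ^+ 2 / (2 *+ 2) + - x ^+ 2 / (2 *+ 2))%R; last by field.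
    rewrite expRD mulrA ler_wpM2r ?expR_ge0//.
    rewrite (_ : - x ^+ 2 / (2 *+ 2) = - (x ^+ 2 / 4))%R; last by field.
    rewrite expRN ler_pdivrMr ?expR_gt0//.
    by have := expR_ge1Dx (x ^+ 2 / 4)%R; lra.
rewrite ge0_integralZl//; last 2 first.
- by apply/measurable_EFinP; exact: measurable_normal_pdf.
- by move=> x _; rewrite lee_fin normal_pdf_ge0.
by rewrite integral_normal_pdf mule1 ltry.
Qed.

(** Scaling: the substitution [x -> s x] carries this density to the standard one. *)
Lemma normal_second_moment (s : R) : (0 < s)%R ->
  \int[normal_prob 0 s]_x (x ^+ 2)%:E = (gaussian_second_moment * s ^+ 2)%:E.
Proof.
move=> s_gt0; have s0 : s != 0%R by rewrite gt_eqF.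
rewrite mulrC EFinM -gaussian_second_momentE !ge0_integral_normal_prob//.
under eq_integral do rewrite -EFinM.
pose F (x : R) : R := (s * x)%R.
have dF : F^`()%classic = cst s.
  by apply/funext => x; rewrite derive1E /F deriveZ//= derive_id scaler1.
rewrite (@increasing_ge0_integration_by_substitutionT R F).
- rewrite -ge0_integralZl//; last 2 first.
  + apply: emeasurable_funM => //; apply/measurable_EFinP.
    exact: measurable_normal_pdf.
  + by move=> x _; rewrite mule_ge0// lee_fin normal_pdf_ge0.
  apply: eq_integral => x _; rewrite -!EFinM; congr EFin.
  rewrite dF !fctE/= /F !normal_pdfE ?oner_eq0// /normal_fun /normal_peak !subr0.
  rewrite (_ : - (s * x) ^+ 2 / (s ^+ 2 *+ 2) = - x ^+ 2 / (1 ^+ 2 *+ 2))%R; last by field.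
  rewrite -[(s ^+ 2 * pi *+ 2)%R]mulrnAr sqrtrM ?sqr_ge0// sqrtr_sqr gtr0_norm//.
  rewrite expr1n mul1r; field; rewrite s0 gt_eqF// sqrtr_gt0.
  by rewrite pmulrn_lgt0// pi_gt0.
- by move=> x y xy; rewrite /F ltr_pM2l.
- by rewrite dF => ?; exact: cvg_cst.
- by rewrite dF; exact: is_cvg_cst.
- by rewrite dF; exact: is_cvg_cst.
- by move=> x; apply: derivableM.
- apply/gt0_cvgMrNy => //; exact: cvg_id.
- apply/gt0_cvgMry => //; exact: cvg_id.
- move=> x; apply: cvgM; first exact: sqr_continuous.
  exact: continuous_normal_pdf.
- by move=> x; rewrite mulr_ge0 ?sqr_ge0// normal_pdf_ge0.
Qed.

End normal_moments.

(** * Integrals over an event on which a variable follows a multiple of a normal law *)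

Section normal_law.
Local Open Scope ereal_scope.
Context {R : realType} {dO : measure_display} {Omega : measurableType dO}.
Variables (P : probability Omega R) (A : set Omega) (V : Omega -> R).
Variables (c s : R).
Hypotheses (mA : measurable A) (mV : measurable_fun setT V).
Hypotheses (c_ge0 : (0 <= c)%R) (s_gt0 : (0 < s)%R).
Hypothesis law : forall B : set (measurableTypeR R), measurable B ->
  P (A `&` V @^-1` B) = c%:E * normal_prob 0 s B.

(** With [A] in the past and [c = P A], the hypothesis [law] expresses the conditional law of an
    increment. A free [c] also allows [A] to be cut by an event on another coordinate. *)
Lemma ge0_integral_law (g : R -> \bar R) :
  measurable_fun [set: measurableTypeR R] g -> (forall x, 0 <= g x) ->
  \int[P]_(w in A) g (V w) = c%:E * \int[normal_prob 0 s]_x g x.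
Proof.
move=> mg g0.
have mgV : measurable_fun setT (g \o V) by exact: measurableT_comp.
transitivity (\int[mrestr P mA]_(w in A) g (V w)).
  apply: eq_measure_integral => B mB BA.
  by rewrite /= /mrestr setIidl.
transitivity (\int[mrestr P mA]_w g (V w)).
  rewrite [RHS](ge0_negligible_integral (N := ~` A))//.
  - by rewrite setDE setCK setTI.
  - exact: measurableC.
  - by rewrite /= /mrestr setICl measure0.
transitivity (\int[pushforward (mrestr P mA) (V : Omega -> measurableTypeR R)]_x g x).
  by rewrite ge0_integral_pushforward.
transitivity (\int[mscale (NngNum c_ge0) (normal_prob 0 s)]_x g x).
  apply: eq_measure_integral => B mB _.
  by rewrite /= /pushforward /mrestr /mscale/= setIC law.
by rewrite ge0_integral_mscale.
Qed.

Lemma integral_law_sqr :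
  \int[P]_(w in A) (V w ^+ 2)%:E = (c * gaussian_second_moment * s ^+ 2)%:E.
Proof.
rewrite (@ge0_integral_law (fun x => (x ^+ 2)%:E)).
- by rewrite normal_second_moment// -EFinM mulrA.
- by apply/measurable_EFinP; exact: exprn_measurable.
- by move=> x; rewrite lee_fin sqr_ge0.
Qed.

Lemma Rintegral_law : Rintegral P A V = 0%R.
Proof.
rewrite /Rintegral integralE.
have pos x : (EFin \o V)^\+ x = maxe (V x)%:E 0 by rewrite funeposE.
have neg x : (EFin \o V)^\- x = maxe (- (V x))%R%:E 0 by rewrite funenegE.
under eq_integral do rewrite pos.
under [X in _ - X]eq_integral do rewrite neg.
have mmax : measurable_fun [set: measurableTypeR R] (fun x : R => maxe x%:E 0).
  by apply: measurable_maxe => //; exact/measurable_EFinP.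
rewrite (@ge0_integral_law (fun x => maxe x%:E 0))//; last first.
  by move=> x; rewrite le_max lexx orbT.
rewrite (@ge0_integral_law (fun x => maxe (- x)%R%:E 0)); last 2 first.
- by apply: (@measurableT_comp _ _ _ _ _ _ (fun x : R => maxe x%:E 0)) => //; exact: measurable_funN.
- by move=> x; rewrite le_max lexx orbT.
rewrite (@integral_normal_probN R s (fun x => maxe x%:E 0)) ?gt_eqF//; last first.
  by move=> x; rewrite le_max lexx orbT.
(* Positive and negative parts have the same integral by symmetry. Were it infinite, [fine] would
   send the difference of the infinities to 0 as well, so both cases give 0. *)
set I := \int[_]_x _; have [I_fin|] := boolP (c%:E * I \is a fin_num).
  by rewrite subee.
rewrite ge0_fin_numE ?mule_ge0 ?lee_fin//; last first.
  by apply: integral_ge0 => x _; rewrite le_max lexx orbT.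
by rewrite -leNgt leye_eq => /eqP ->.
Qed.

End normal_law.

(** * Conditional centering *)

Section finite_linearity.
Context {R : realType} {dT : measure_display} {T : measurableType dT}.
Variables (mu : {measure set T -> \bar R}) (D : set T).
Hypothesis mD : measurable D.
Local Notation E f := (Rintegral mu D f).
Local Notation integrable f := (mu.-integrable D (EFin \o f)).
Implicit Types f g : T -> R.

Lemma integrable_measurable f : integrable f -> measurable_fun D f.
Proof. by move=> /measurable_int /measurable_EFinP. Qed.

Lemma integrable_dominated f g : measurable_fun D f -> integrable g ->
  (forall w, `|f w| <= g w) -> integrable f.
Proof.
move=> mf ig fg; apply: le_integrable ig => //; first exact/measurable_EFinP.
by move=> w _ /=; rewrite lee_fin (le_trans (fg w))// ler_norm.
Qed.

Lemma integrable_addr f g : integrable f -> integrable g ->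
  integrable (fun w => f w + g w).
Proof. by move=> fi gi; have := integrableD mD fi gi. Qed.

Lemma integrable_mull c f : integrable f -> integrable (fun w => c * f w).
Proof. by move=> fi; have := integrableZl mD c fi. Qed.

Lemma integrable_bigsum (I : Type) (s : seq I) (f : I -> T -> R) :
  (forall i, integrable (f i)) -> integrable (fun w => \sum_(i <- s) f i w).
Proof.
move=> fi; elim: s => [|i s ih].
  by under eq_fun do rewrite big_nil; exact: integrable0.
by under eq_fun do rewrite big_cons; exact: integrable_addr.
Qed.

Lemma Rintegral_sum (I : Type) (s : seq I) (f : I -> T -> R) :
  (forall i, integrable (f i)) ->
  E (fun w => \sum_(i <- s) f i w) = \sum_(i <- s) E (f i).
Proof.
move=> fi; elim: s => [|i s ih].
  rewrite big_nil; under eq_Rintegral do rewrite big_nil.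
  by rewrite /Rintegral integral0.
rewrite big_cons -ih; under eq_Rintegral do rewrite big_cons.
by rewrite RintegralD//; exact: integrable_bigsum.
Qed.

Lemma Rintegral_mull c f : integrable f -> E (fun w => c * f w) = c * E f.
Proof. by move=> fi; rewrite RintegralZl. Qed.

Lemma Rintegral_add f g : integrable f -> integrable g ->
  E (fun w => f w + g w) = E f + E g.
Proof. by move=> fi gi; rewrite RintegralD. Qed.

Lemma Rintegral_eq0 f : (forall w, f w = 0) -> E f = 0.
Proof. by move=> f0; rewrite /Rintegral integral0_eq// => w _; rewrite f0. Qed.

Lemma EFin_Rintegral f : integrable f -> (E f)%:E = (\int[mu]_(x in D) (f x)%:E)%E.
Proof. by move=> fi; rewrite fineK//; exact: integrable_fin_num. Qed.

End finite_linearity.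

Section centered.
Context {R : realType} {dO : measure_display} {Omega : measurableType dO}.
Variable P : probability Omega R.
Local Notation E f := (Rintegral P setT f).
Local Notation integrable f := (P.-integrable setT (EFin \o f)).
Implicit Types f g phi V : Omega -> R.

Lemma integrable_cst c : integrable (fun=> c).
Proof. exact: finite_measure_integrable_cst. Qed.

Lemma Rintegral_indic (A : set Omega) V : measurable A ->
  E (fun w => \1_A w * V w) = Rintegral P A V.
Proof.
move=> mA; rewrite [RHS]Rintegral_mkcond; apply: eq_Rintegral => w _.
by rewrite patchE indicE; case: ifPn => _; rewrite ?mul1r ?mul0r.
Qed.

Lemma integrable_indic_mul (A : set Omega) V : measurable A -> integrable V ->
  integrable (fun w => \1_A w * V w).
Proof.
move=> mA iV; apply: (@integrable_dominated _ _ _ P _ measurableT _ (fun w => `|V w|)).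
- by apply: measurable_funM; [exact: measurable_indic|exact: (integrable_measurable iV)].
- by have := integrable_abse iV.
- move=> w; rewrite normrM ger0_norm ?indicE//.
  by case: (_ \in _); rewrite ?mul1r ?mul0r.
Qed.

Import HBNNSimple.

Let sample_nnsfun phi V (g : {nnsfun (measurableTypeR R) >-> R}) :
  measurable_fun setT phi -> integrable V ->
  (forall B : set (measurableTypeR R), measurable B ->
     Rintegral P (phi @^-1` B) V = 0) ->
  E (fun w => g (phi w) * V w) = 0.
Proof.
move=> mphi iV V0.
have mg : measurable_fun [set: measurableTypeR R] g by exact: measurable_funP.
have mgr r : measurable (g @^-1` [set r] : set (measurableTypeR R)).
  by rewrite -[_ @^-1` _]setTI; exact: mg.
have mB r : measurable ((phi @^-1` (g @^-1` [set r])) : set Omega).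
  by have := mphi measurableT _ (mgr r); rewrite setTI.
pose s : seq R := finmap.enum_fset (fset_set (range g)).
transitivity (E (fun w => \sum_(r <- s) r * (\1_(phi @^-1` (g @^-1` [set r])) w * V w))).
  apply: eq_Rintegral => w _; rewrite {1}fimfunE fsbig_finite//= mulr_suml.
  by apply: eq_bigr => r _; rewrite mulrA.
rewrite (Rintegral_sum measurableT) => [|r]; last by apply: integrable_mull => //; apply: integrable_indic_mul.
rewrite big1// => r _; rewrite (Rintegral_mull measurableT) ?Rintegral_indic ?V0 ?mulr0//.
exact: integrable_indic_mul.
Qed.

(** The simple functions approximate [x -> max(x, 0)] on the line and are then evaluated at [phi],
    so that their level sets are preimages under [phi], the events on which [V] is known to be
    centered. The passage to the limit is dominated by [|phi V|]. *)
Let centered_pos phi V :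
  measurable_fun setT phi -> integrable V -> integrable (fun w => phi w * V w) ->
  (forall B : set (measurableTypeR R), measurable B ->
     Rintegral P (phi @^-1` B) V = 0) ->
  E (fun w => Num.max (phi w) 0 * V w) = 0.
Proof.
move=> mphi iV ipV V0.
pose p (x : R) : R := Num.max x 0.
have mp : measurable_fun [set: measurableTypeR R] (EFin \o p).
  by apply/measurable_EFinP; apply: measurable_maxr.
have p0 x : (0 <= (EFin \o p) x)%E by rewrite lee_fin le_max lexx orbT.
pose g := nnsfun_approx measurableT mp.
have g_cvg x : (g n x)%:E @[n --> \oo] --> (p x)%:E.
  by apply: (cvg_nnsfun_approx measurableT mp) => // ? _; exact: p0.
have g_le n x : g n x <= p x.
  by rewrite -lee_fin nnsfun_approxE; apply: le_approx => // ? _; exact: p0.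
have mV := integrable_measurable iV.
have g_norm n x : `|g n x| <= `|x|.
  rewrite ger0_norm ?fun_ge0// (le_trans (g_le n x))// /p.
  by case: (leP x 0) => // _; exact: ler_norm.
have mgV n : measurable_fun setT (fun w => (g n (phi w) * V w)%:E).
  have mg : measurable_fun [set: measurableTypeR R] (g n) by exact: measurable_funP.
  by apply/measurable_EFinP; apply: measurable_funM => //; exact: measurableT_comp.
have gV0 n : (\int[P]_w (g n (phi w) * V w)%:E = 0)%E.
  rewrite -[LHS]fineK; first by rewrite [fine _]sample_nnsfun.
  apply: integrable_fin_num => //; apply: le_integrable ipV => // w _ /=.
  by rewrite lee_fin !normrM ler_wpM2r.
have : (fun n => \int[P]_w (g n (phi w) * V w)%:E)%E @ \oo -->
    (\int[P]_w (p (phi w) * V w)%:E)%E.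
  apply: (@dominated_cvg _ _ _ P setT measurableT _ _
    (fun w => `|phi w * V w|%:E)) => //.
  - move=> w _.
    have := cvgeZr (f := fun n => (g n (phi w))%:E) (y := (V w)%:E) isT (g_cvg (phi w)).
    by rewrite -EFinM.
  - by have := integrable_abse ipV.
  - by move=> n w _ /=; rewrite lee_fin !normrM ler_wpM2r.
under eq_fun do rewrite gV0.
by rewrite /Rintegral => /(cvg_unique _ (cvg_cst _)) <-.
Qed.

(** The last hypothesis says that the conditional expectation of [V] given [phi] is zero, tested on
    events. In this form independence can be exploited without constructing conditional
    expectations. *)
Lemma centered_mul phi V :
  measurable_fun setT phi -> integrable V -> integrable (fun w => phi w * V w) ->
  (forall B : set (measurableTypeR R), measurable B ->
     Rintegral P (phi @^-1` B) V = 0) ->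
  E (fun w => phi w * V w) = 0.
Proof.
move=> mphi iV ipV V0.
pose N w := - phi w.
have mN : measurable_fun setT N by exact: measurable_funN.
have iNV : integrable (fun w => N w * V w).
  have := integrable_mull measurableT (-1) ipV; apply: eq_integrable => // w _.
  by rewrite /N; congr EFin; rewrite /=; ring.
have N0 (B : set (measurableTypeR R)) : measurable B -> Rintegral P (N @^-1` B) V = 0.
  move=> mB; have /V0 : measurable ((fun x : measurableTypeR R => - x : measurableTypeR R) @^-1` B).
    by rewrite -[_ @^-1` _]setTI; exact: oppr_measurable.
  exact.
have pos := centered_pos mphi iV ipV V0.
have neg := centered_pos mN iV iNV N0.
have im f : measurable_fun setT f -> integrable (fun w => f w * V w) ->
    integrable (fun w => Num.max (f w) 0 * V w).
  move=> mf ifV; apply: (@integrable_dominated _ _ _ P _ measurableT _ (fun w => `|f w * V w|)).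
  - apply: measurable_funM; last exact: (integrable_measurable iV).
    exact: measurable_maxr.
  - by have := integrable_abse ifV.
  - move=> w; rewrite !normrM ler_wpM2r//.
    by case: (leP (f w) 0) => h; rewrite ?normr0.
transitivity (E (fun w => Num.max (phi w) 0 * V w + (-1) * (Num.max (N w) 0 * V w))).
  apply: eq_Rintegral => w _; rewrite /N.
  by case: (leP (phi w) 0) => h; case: (leP (- phi w) 0) => h';
    [have -> : phi w = 0 by lra|..]; lra.
rewrite (Rintegral_add measurableT) ?(Rintegral_mull measurableT) ?pos ?neg ?mulr0 ?addr0//.
- exact: im.
- exact: im.
- by apply: integrable_mull => //; apply: im.
Qed.

End centered.

(** * The Ito isometry for step processes *)

Section brownian_increments.
Context {R : realType} {d : nat} {dO : measure_display} {Omega : measurableType dO}.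
Variables (P : probability Omega R) (F : R -> set (set Omega)).
Variable W : R -> Omega -> 'cV[R]_d.
Hypotheses (hF : filtration F) (hW : brownian_motion P F W).
Local Notation E f := (Rintegral P setT f).
Local Notation integrable f := (P.-integrable setT (EFin \o f)).
Local Notation c2 := (@gaussian_second_moment R).
Implicit Types (f g phi psi : Omega -> R) (i j : 'I_d) (a c s t : R).

Definition measurable_for (G : set (set Omega)) f :=
  forall B : set (measurableTypeR R), measurable B -> G (f @^-1` B).

(** Turns a bare sigma-algebra of sets into a measurable type, so that the closure properties of
    measurable functions apply to each [F t]. *)
Lemma measurable_forP (G : set (set Omega)) f : sigma_algebra setT G ->
  measurable_for G f <->
  measurable_fun [set: g_sigma_algebraType G] (f : g_sigma_algebraType G -> R).
Proof.
move=> sG; split=> [Gf _ B mB|mf B mB].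
  by rewrite setTI /measurable/= sigma_algebra_id//; exact: Gf.
have := mf measurableT B mB.
by rewrite setTI {1}/measurable/= sigma_algebra_id.
Qed.

Lemma filtration_sigma t : 0 <= t -> sigma_algebra setT (F t).
Proof. by case: hF => sF _ _; exact: sF. Qed.

Lemma measurable_for_le s t f : 0 <= s -> s <= t ->
  measurable_for (F s) f -> measurable_for (F t) f.
Proof. by case: hF => _ _ Fle s0 st Ff B mB; apply: (Fle s) => //; exact: Ff. Qed.

Lemma measurable_for_measurable t f : 0 <= t ->
  measurable_for (F t) f -> measurable_fun setT f.
Proof. by case: hF => _ Fm _ t0 Ff _ B mB; rewrite setTI; apply: (Fm t) => //; exact: Ff. Qed.

Lemma measurable_forM t f g : 0 <= t -> measurable_for (F t) f ->
  measurable_for (F t) g -> measurable_for (F t) (fun w => f w * g w).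
Proof.
move=> t0; have sF := filtration_sigma t0.
rewrite !(measurable_forP _ sF) => mf mg; exact: measurable_funM.
Qed.

Lemma measurable_forB t f g : 0 <= t -> measurable_for (F t) f ->
  measurable_for (F t) g -> measurable_for (F t) (fun w => f w - g w).
Proof.
move=> t0; have sF := filtration_sigma t0.
rewrite !(measurable_forP _ sF) => mf mg; exact: measurable_funB.
Qed.

Definition incr i s t (w : Omega) : R := W t w i 0 - W s w i 0.

Lemma incr_split i a s c w : incr i a c w = incr i a s w + incr i s c w.
Proof. by rewrite /incr; ring. Qed.

Lemma incr_id i s w : incr i s s w = 0.
Proof. by rewrite /incr subrr. Qed.

Lemma measurable_for_incr i s t u : 0 <= s -> 0 <= t -> s <= u -> t <= u ->
  measurable_for (F u) (incr i s t).
Proof.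
case: hW => Wad _ _ _ s0 t0 su tu.
apply: measurable_forB; first exact: le_trans su.
- by apply: (measurable_for_le t0 tu) => B; exact: Wad.
- by apply: (measurable_for_le s0 su) => B; exact: Wad.
Qed.

Lemma measurable_incr i s t : 0 <= s -> 0 <= t -> measurable_fun setT (incr i s t).
Proof.
move=> s0 t0; apply: (@measurable_for_measurable (Num.max s t)).
  by rewrite le_max s0.
by apply: measurable_for_incr => //; rewrite le_max lexx ?orbT.
Qed.

Lemma incr_law i s t (A : set Omega) (B : set (measurableTypeR R)) :
  0 <= s -> s < t -> F s A -> measurable B ->
  P (A `&` incr i s t @^-1` B) = (P A * normal_prob 0 (Num.sqrt (t - s)) B)%E.
Proof.
case: hW => _ _ law _ s0 st FA mB.
(* The other coordinates are given the whole line, whose factors in the product equal 1. *)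
have := law _ _ s0 st A (fun k => if k == i then B else setT) FA.
rewrite (bigD1 i)//= eqxx big1 ?mule1 => [|k /negbTE ->]; last exact: probability_setT.
move=> <-; last by move=> k; case: ifP.
congr (P (A `&` _)); apply/seteqP; split=> w /= H; last by have := H i; rewrite eqxx.
by move=> k; case: ifPn => // /eqP ->.
Qed.

Lemma incr_law2 i j s t (A : set Omega) (B C : set (measurableTypeR R)) :
  i != j -> 0 <= s -> s < t -> F s A -> measurable B -> measurable C ->
  P ((A `&` incr i s t @^-1` B) `&` incr j s t @^-1` C) =
  (P A * normal_prob 0 (Num.sqrt (t - s)) B * normal_prob 0 (Num.sqrt (t - s)) C)%E.
Proof.
case: hW => _ _ law _ ij s0 st FA mB mC.
have := law _ _ s0 st A (fun k => if k == i then B else if k == j then C else setT) FA.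
have ji : (j == i) = false by rewrite eq_sym (negbTE ij).
rewrite (bigD1 i)//= eqxx (bigD1 j) ?ji//= eqxx big1 ?mule1; last first.
  by move=> k /andP[/negbTE -> /negbTE ->]; exact: probability_setT.
rewrite -muleA => <-; last by move=> k; case: ifP => // _; case: ifP.
rewrite -setIA; congr (P (A `&` _)); apply/seteqP; split=> w /=.
  by move=> [H1 H2] k; case: ifPn => [/eqP ->//|_]; case: ifPn => [/eqP ->|].
move=> H; split; first by have := H i; rewrite eqxx.
by have := H j; rewrite ji eqxx.
Qed.

Let sd_gt0 s t : s < t -> 0 < Num.sqrt (t - s).
Proof. by move=> st; rewrite sqrtr_gt0 subr_gt0. Qed.

Let Fmeas s A : 0 <= s -> F s A -> measurable A.
Proof. by case: hF => _ Fm _ s0; exact: Fm. Qed.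

Let fineP (A : set Omega) : measurable A -> P A = (fine (P A))%:E.
Proof. by move=> mA; rewrite fineK// fin_num_measure. Qed.

Lemma Rintegral_incr i s t A : 0 <= s -> s <= t -> F s A ->
  Rintegral P A (incr i s t) = 0.
Proof.
(* The case [s = t] is apart: the law of increments is given for [s < t], with a positive standard
   deviation. *)
move=> s0; rewrite le_eqVlt => /predU1P[->|st] FA.
  by apply: Rintegral_eq0 => w; rewrite incr_id.
have mA := Fmeas s0 FA.
apply: (@Rintegral_law _ _ _ P A _ (fine (P A)) (Num.sqrt (t - s))) => //.
- by apply: measurable_incr => //; rewrite (le_trans s0)// ltW.
- exact: fine_ge0.
- exact: sd_gt0.
- by move=> B mB; rewrite -fineP// incr_law.
Qed.

Lemma integral_incr_sqr i s t A : 0 <= s -> s < t -> F s A ->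
  (\int[P]_(w in A) (incr i s t w ^+ 2)%:E = (fine (P A) * c2 * (t - s))%:E)%E.
Proof.
move=> s0 st FA; have mA := Fmeas s0 FA.
rewrite (@integral_law_sqr _ _ _ P A _ (fine (P A)) (Num.sqrt (t - s)))//.
- by rewrite sqr_sqrtr// subr_ge0 ltW.
- by apply: measurable_incr => //; rewrite (le_trans s0)// ltW.
- exact: fine_ge0.
- exact: sd_gt0.
- by move=> B mB; rewrite -fineP// incr_law.
Qed.

Let FT s : 0 <= s -> F s setT.
Proof.
move=> s0; have [F0 FC _] := filtration_sigma s0.
by have := FC set0 F0; rewrite setD0.
Qed.

(** Measurability of [f] is a separate clause since it does not follow from that of its square. *)
Definition sq_integrable f :=
  measurable_fun setT f /\ integrable (fun w => f w ^+ 2).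

Lemma integrableM f g : sq_integrable f -> sq_integrable g ->
  integrable (fun w => f w * g w).
Proof.
move=> [mf f2] [mg g2].
apply: (integrable_dominated measurableT _ (integrable_addr measurableT f2 g2)).
  exact: measurable_funM.
move=> w; rewrite ler_norml.
have := sqr_ge0 (f w - g w); have := sqr_ge0 (f w + g w).
by have := sqr_ge0 (f w); have := sqr_ge0 (g w); lra.
Qed.

Lemma sq_integrableM b phi f : measurable_fun setT phi ->
  (forall w, `|phi w| <= b) -> sq_integrable f ->
  sq_integrable (fun w => phi w * f w).
Proof.
move=> mphi phib [mf f2]; split; first exact: measurable_funM.
apply: (integrable_dominated measurableT _ (integrable_mull measurableT (b ^+ 2) f2)).
  by apply: measurable_funX; exact: measurable_funM.
move=> w; rewrite ger0_norm ?sqr_ge0// exprMn ler_wpM2r ?sqr_ge0//.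
by rewrite -(real_normK (num_real (phi w))) lerXn2r ?nnegrE// (le_trans _ (phib w)).
Qed.

Lemma sq_integrable_incr i s t : 0 <= s -> s <= t -> sq_integrable (incr i s t).
Proof.
move=> s0 st; split; first by apply: measurable_incr => //; exact: le_trans st.
have m2 : measurable_fun setT (fun w => incr i s t w ^+ 2).
  by apply: measurable_funX; apply: measurable_incr => //; exact: le_trans st.
move: st; rewrite le_eqVlt => /predU1P[<-|st].
  rewrite (_ : (fun w => _) = cst 0); first exact: integrable_cst.
  by apply/funext => w; rewrite incr_id expr0n.
apply/integrableP; split; first exact/measurable_EFinP.
under eq_integral do rewrite /= ger0_norm ?sqr_ge0//.
by rewrite integral_incr_sqr ?ltry//; exact: FT.
Qed.

Lemma sq_integrable_bounded b phi : measurable_fun setT phi ->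
  (forall w, `|phi w| <= b) -> sq_integrable phi.
Proof.
move=> mphi phib; rewrite (_ : phi = fun w => phi w * 1); last first.
  by apply/funext => w; rewrite mulr1.
apply: (sq_integrableM mphi phib); split => //.
by apply: integrable_cst.
Qed.

Lemma sq_integrable_integrable f : sq_integrable f -> integrable f.
Proof.
move=> sf; have : sq_integrable (fun=> 1).
  by apply: (@sq_integrable_bounded 1) => // w; rewrite normr1.
by move=> /(integrableM sf); under eq_fun do rewrite mulr1.
Qed.

Lemma expect_incr i s t phi : 0 <= s -> s <= t -> measurable_for (F s) phi ->
  sq_integrable phi -> E (fun w => phi w * incr i s t w) = 0.
Proof.
move=> s0 st Fphi sphi; apply: centered_mul.
- by case: sphi.
- exact/sq_integrable_integrable/sq_integrable_incr.
- by apply: integrableM => //; exact: sq_integrable_incr.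
- by move=> B mB; apply: Rintegral_incr => //; exact: Fphi.
Qed.

Lemma Rintegral_incrM i j s t A : 0 <= s -> s <= t -> F s A ->
  Rintegral P A (fun w => incr i s t w * incr j s t w - (i == j)%:R * c2 * (t - s)) = 0.
Proof.
move=> s0 st FA; have mA := Fmeas s0 FA.
have t0 := le_trans s0 st.
move: (st); rewrite le_eqVlt => /predU1P[<-|st'].
  by apply: Rintegral_eq0 => w; rewrite !incr_id subrr !mulr0 subr0.
have iM : P.-integrable A (EFin \o (fun w => incr i s t w * incr j s t w)).
  apply: (integrableS measurableT) => //.
  by apply: integrableM; exact: sq_integrable_incr.
have iC : P.-integrable A (EFin \o (fun=> (i == j)%:R * c2 * (t - s))).
  exact: finite_measure_integrable_cst.
rewrite (RintegralB mA iM iC) Rintegral_cst//; apply/eqP; rewrite subr_eq0; apply/eqP.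
have [<-|ij] := eqVneq i j.
  rewrite mul1r mulrC mulrA -[RHS]/(fine (_)%:E) -(integral_incr_sqr i s0 st' FA).
  by congr fine; apply: eq_integral => w _; rewrite expr2.
(* Off the diagonal, [centered_mul] is applied with [incr i] as [phi] and the other increment cut to
   [A] as [V]. On [A] and [incr i] in [B], the increment [incr j] still follows a multiple of the
   normal law, by [incr_law2], and is thus centered. *)
rewrite !mul0r -Rintegral_indic//.
under eq_Rintegral do rewrite mulrCA.
have mi : measurable_fun setT (incr i s t) by exact: measurable_incr.
have mj : measurable_fun setT (incr j s t) by exact: measurable_incr.
apply: centered_mul => //.
- by apply: integrable_indic_mul => //; apply/sq_integrable_integrable/sq_integrable_incr.
- apply: integrableM; first exact: sq_integrable_incr.
  apply: (@sq_integrableM 1); [exact: measurable_indic| |exact: sq_integrable_incr].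
  by move=> w; rewrite indicE; case: (_ \in _); rewrite ?normr1 ?normr0.
move=> B mB; rewrite -Rintegral_indic; last first.
  by rewrite -[X in measurable X]setTI; exact: mi.
under eq_Rintegral do rewrite mulrA.
rewrite (_ : (fun w => _) = (fun w => \1_(A `&` incr i s t @^-1` B) w * incr j s t w)); last first.
  by apply/funext => w; rewrite indicI/= [X in X * _ = _]mulrC.
have mAB : measurable (A `&` incr i s t @^-1` B).
  by apply: measurableI => //; rewrite -[X in measurable X]setTI; exact: mi.
rewrite Rintegral_indic//.
pose c := (fine (P A) * fine (normal_prob 0 (Num.sqrt (t - s)) B))%R.
apply: (@Rintegral_law _ _ _ P _ _ c (Num.sqrt (t - s))) => //.
- by rewrite mulr_ge0// fine_ge0.
- exact: sd_gt0.
move=> C mC; rewrite incr_law2// /c EFinM -fineP// fineK//.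
exact: fin_num_measure.
Qed.

Lemma expect_incrM b i j s t phi : 0 <= s -> s <= t -> measurable_for (F s) phi ->
  (forall w, `|phi w| <= b) ->
  E (fun w => phi w * (incr i s t w * incr j s t w)) =
  (i == j)%:R * c2 * (t - s) * E phi.
Proof.
move=> s0 st Fphi phib; have mphi := measurable_for_measurable s0 Fphi.
set c := (i == j)%:R * c2 * (t - s).
have iphi : integrable phi.
  by apply/sq_integrable_integrable; exact: sq_integrable_bounded phib.
have iphiM : integrable (fun w => phi w * (incr i s t w * incr j s t w)).
  under eq_fun do rewrite mulrA.
  apply: integrableM; last exact: sq_integrable_incr.
  by apply: sq_integrableM phib _ => //; exact: sq_integrable_incr.
have iM : integrable (fun w => incr i s t w * incr j s t w).
  by apply: integrableM; exact: sq_integrable_incr.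
apply/eqP; rewrite -subr_eq0 -(Rintegral_mull measurableT)// -RintegralB//; last first.
  exact: integrable_mull.
apply/eqP; transitivity (E (fun w => phi w * (incr i s t w * incr j s t w - c))).
  by apply: eq_Rintegral => w _; ring.
apply: centered_mul => //.
- by apply: (integrable_addr measurableT iM); exact: integrable_cst.
- have := integrable_addr measurableT iphiM (integrable_mull measurableT (- c) iphi).
  by apply: eq_integrable => // w _; congr EFin; rewrite /=; ring.
- by move=> B mB; apply: Rintegral_incrM => //; exact: Fphi.
Qed.

(** The longer increment is cut at the end of the shorter one; the remaining piece is centered given
    what precedes it. *)
Lemma expect_incr_same_start b i j a c c' chi : 0 <= a -> a <= c -> a <= c' ->
  measurable_for (F a) chi -> (forall w, `|chi w| <= b) ->
  E (fun w => chi w * (incr i a c w * incr j a c' w)) =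
  (i == j)%:R * c2 * (Num.min c c' - a) * E chi.
Proof.
move=> a0; wlog cc' : i j c c' / c <= c' => [hw ac ac' Fchi chib|].
  have [cc'|/ltW c'c] := leP c c'; first by rewrite hw// min_l.
  by under eq_Rintegral do rewrite [X in _ * X]mulrC; rewrite hw// min_l// eq_sym.
move=> ac ac' Fchi chib; rewrite min_l//.
have mchi := measurable_for_measurable a0 Fchi.
have sq1 : sq_integrable (fun w => chi w * incr i a c w).
  by apply: sq_integrableM chib _ => //; exact: sq_integrable_incr.
have c0 := le_trans a0 ac.
transitivity (E (fun w => chi w * (incr i a c w * incr j a c w) +
    chi w * incr i a c w * incr j c c' w)).
  by apply: eq_Rintegral => w _; rewrite (incr_split j a c c'); ring.
rewrite Rintegral_add//; last 2 first.
- under eq_fun do rewrite mulrA.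
  by apply: integrableM => //; exact: sq_integrable_incr.
- by apply: integrableM => //; exact: sq_integrable_incr.
rewrite (expect_incrM _ _ _ _ Fchi chib)// expect_incr ?addr0//.
apply: measurable_forM => //; first exact: measurable_for_le Fchi.
exact: measurable_for_incr.
Qed.

(** The length of the intersection of []a, c]] and []a', c']]. *)
Definition overlap a c a' c' := Num.max 0 (Num.min c c' - Num.max a a').

Lemma overlapC a c a' c' : overlap a c a' c' = overlap a' c' a c.
Proof. by rewrite /overlap minC [Num.max a a']maxC. Qed.

(* The increments cut at the later starting point [a'] : what happens before is
   known at time [a'] and so is uncorrelated with the increment after [a']. *)
Lemma expect_incr_pair b i j a c a' c' phi psi :
  0 <= a -> a <= c -> 0 <= a' -> a' <= c' ->
  measurable_for (F a) phi -> measurable_for (F a') psi ->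
  (forall w, `|phi w| <= b) -> (forall w, `|psi w| <= b) ->
  E (fun w => (phi w * incr i a c w) * (psi w * incr j a' c' w)) =
  (i == j)%:R * c2 * overlap a c a' c' * E (fun w => phi w * psi w).
Proof.
wlog aa' : i j a c a' c' phi psi / a <= a' => [hw a0 ac a'0 a'c' Fphi Fpsi phib psib|].
  have [aa'|/ltW a'a] := leP a a'; first by rewrite hw.
  under eq_Rintegral do rewrite mulrC.
  under [in RHS]eq_Rintegral do rewrite mulrC.
  by rewrite hw// eq_sym overlapC.
move=> a0 ac a'0 a'c' Fphi Fpsi phib psib.
have mphi := measurable_for_measurable a0 Fphi.
have mpsi := measurable_for_measurable a'0 Fpsi.
have Fphi' := measurable_for_le a0 aa' Fphi.
have b0 : 0 <= b by apply: le_trans (phib point).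
have chib w : `|phi w * psi w| <= b * b by rewrite normrM ler_pM.
have mchi : measurable_fun setT (fun w => phi w * psi w) by exact: measurable_funM.
have Fchi : measurable_for (F a') (fun w => phi w * psi w) by exact: measurable_forM.
have [ca'|/ltW a'c] := leP c a'.
  rewrite /overlap max_l; last first.
    by rewrite subr_le0 (max_r aa') ge_min ca'.
  rewrite mulr0 mul0r.
  transitivity (E (fun w => (phi w * psi w * incr i a c w) * incr j a' c' w)).
    by apply: eq_Rintegral => w _; ring.
  apply: expect_incr => //.
  - apply: measurable_forM => //; apply: measurable_for_incr => //.
    exact: le_trans ac.
  - by apply: sq_integrableM chib _ => //; exact: sq_integrable_incr.
rewrite /overlap max_r; last by rewrite subr_ge0 (max_r aa') le_min a'c.
have sq1 : sq_integrable (fun w => phi w * psi w * incr i a a' w).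
  by apply: sq_integrableM chib _ => //; exact: sq_integrable_incr.
transitivity (E (fun w => (phi w * psi w * incr i a a' w) * incr j a' c' w +
    phi w * psi w * (incr i a' c w * incr j a' c' w))).
  by apply: eq_Rintegral => w _; rewrite (incr_split i a a' c); ring.
rewrite Rintegral_add//; last 2 first.
- by apply: integrableM => //; exact: sq_integrable_incr.
- under eq_fun do rewrite mulrA.
  apply: integrableM; last exact: sq_integrable_incr.
  by apply: sq_integrableM chib _ => //; exact: sq_integrable_incr.
rewrite expect_incr//; last first.
  apply: measurable_forM => //; exact: measurable_for_incr.
rewrite add0r (max_r aa').
exact: (expect_incr_same_start _ _ _ _ _ Fchi chib).
Qed.

(** Intervals may overlap, and [i] may send several indices to the same coordinate of [W]: this is
    the scalar form to which a row of a matrix-valued step integral reduces. *)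
Lemma expect_sqr_incr_sum (K : finType) (a c : K -> R) (i : K -> 'I_d)
    (phi : K -> Omega -> R) (b : R) :
  (forall k, 0 <= a k /\ a k <= c k) ->
  (forall k, measurable_for (F (a k)) (phi k)) ->
  (forall k w, `|phi k w| <= b) ->
  let S w := \sum_k phi k w * incr (i k) (a k) (c k) w in
  integrable (fun w => S w ^+ 2) /\
  E (fun w => S w ^+ 2) = c2 * \sum_k \sum_l
    (i k == i l)%:R * overlap (a k) (c k) (a l) (c l) * E (fun w => phi k w * phi l w).
Proof.
move=> ac Fphi phib S.
have mphi k : measurable_fun setT (phi k).
  by apply: measurable_for_measurable (Fphi k); case: (ac k).
have sq1 k : sq_integrable (fun w => phi k w * incr (i k) (a k) (c k) w).
  apply: sq_integrableM (phib k) _ => //; case: (ac k) => ? ?.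
  exact: sq_integrable_incr.
pose T k l w := (phi k w * incr (i k) (a k) (c k) w) *
  (phi l w * incr (i l) (a l) (c l) w).
have iT k l : integrable (T k l) by exact: integrableM.
have SE : (fun w => S w ^+ 2) = (fun w => \sum_k \sum_l T k l w).
  by apply/funext => w; rewrite expr2 /S mulr_suml; apply: eq_bigr => k _; rewrite mulr_sumr.
rewrite SE; split.
  by apply: integrable_bigsum => // k; apply: integrable_bigsum.
rewrite Rintegral_sum// => [|k]; last exact: integrable_bigsum.
rewrite mulr_sumr; apply: eq_bigr => k _; rewrite Rintegral_sum// mulr_sumr.
apply: eq_bigr => l _; case: (ac k) => ? ?; case: (ac l) => ? ?.
rewrite (expect_incr_pair (i k) (i l) _ _ _ _ (Fphi k) (Fphi l) (phib k) (phib l))//.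
ring.
Qed.

End brownian_increments.

(** * Expected time integrals and Tonelli's theorem *)

Section time_integrals.
Local Open Scope ereal_scope.
Context {R : realType} {dO : measure_display} {Omega : measurableType dO}.
Variables (P : probability Omega R) (t : R).
Local Notation mu := (@lebesgue_measure R).
Local Notation I := (`[0%R, t]%classic : set (measurableTypeR R)).
Implicit Types f g : R -> Omega -> R.

Definition jointly_measurable f :=
  measurable_fun (I `*` [set: Omega]) (fun p : measurableTypeR R * Omega => f p.1 p.2).

Definition time_integral f := \int[P]_w \int[mu]_(s in I) (f s w)%:E.

Let mI : measurable I. Proof. exact: measurable_itv. Qed.

Let mIT : measurable (I `*` [set: Omega]).
Proof. exact: measurableX. Qed.

Lemma jointly_measurable_section f w : jointly_measurable f ->
  measurable_fun I (fun s => (f s w)%:E).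
Proof.
move=> mf; apply/measurable_EFinP.
apply: (@measurable_comp _ _ _ _ _ _ (I `*` [set: Omega])
  (fun p : measurableTypeR R * Omega => f p.1 p.2) I (fun s => (s, w))) => //.
  by move=> _ [s Is <-].
by apply: measurable_funTS; exact: measurable_pair2.
Qed.

(** Extension by zero beyond [[0, t]], to apply Tonelli's theorem on the full product space. *)
Let patched f (p : measurableTypeR R * Omega) : \bar R :=
  ((fun p => (f p.1 p.2)%:E) \_ (I `*` [set: Omega])) p.

Let mpatched f : jointly_measurable f -> measurable_fun setT (patched f).
Proof.
by move=> mf; apply/(measurable_restrictT _ mIT); apply/measurable_EFinP.
Qed.

Let patched_ge0 f : (forall s w, 0 <= f s w)%R -> forall p, 0 <= patched f p.
Proof. by move=> f0 p; apply: erestrict_ge0 => q _; rewrite lee_fin. Qed.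

Let patchedE f w : \int[mu]_(s in I) (f s w)%:E = \int[mu]_s patched f (s, w).
Proof.
rewrite integral_mkcond; apply: eq_integral => s _; rewrite /patched !patchE.
congr (if _ then _ else _); apply/idP/idP; rewrite !inE; first by split.
by case.
Qed.

Lemma measurable_time_integral f : jointly_measurable f ->
  (forall s w, 0 <= f s w)%R ->
  measurable_fun [set: Omega] (fun w => \int[mu]_(s in I) (f s w)%:E).
Proof.
move=> mf f0; under eq_fun do rewrite patchedE.
exact: (measurable_fun_fubini_tonelli_G (patched f) (mpatched mf) (patched_ge0 f0)).
Qed.

Let expectation_patchedE f : (fun s => \int[P]_w (f s w)%:E) \_ I =
  fun s => \int[P]_w patched f (s, w).
Proof.
apply/funext => s; rewrite patchE; case: ifPn => sI.
  apply: eq_integral => w _; rewrite /patched patchE ifT// inE.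
  by move: sI; rewrite inE.
rewrite integral0_eq// => w _; rewrite /patched patchE ifF//.
by apply/negP => /set_mem[/= sIt _]; move/negP: sI; apply; exact: mem_set.
Qed.

Lemma measurable_expectation f : jointly_measurable f ->
  (forall s w, 0 <= f s w)%R ->
  measurable_fun [set: measurableTypeR R] ((fun s => \int[P]_w (f s w)%:E) \_ I).
Proof.
move=> mf f0; rewrite expectation_patchedE.
exact: (measurable_fun_fubini_tonelli_F (patched f) (mpatched mf) (patched_ge0 f0)).
Qed.

Lemma time_integral_swap f : jointly_measurable f -> (forall s w, 0 <= f s w)%R ->
  time_integral f = \int[mu]_(s in I) \int[P]_w (f s w)%:E.
Proof.
move=> mf f0; rewrite /time_integral; under eq_integral do rewrite patchedE.
have := @fubini_tonelli _ _ _ _ R mu P (patched f) (mpatched mf) (patched_ge0 f0).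
by move=> <-; rewrite [RHS]integral_mkcond expectation_patchedE.
Qed.

Lemma time_integral_ge0 f : (forall s w, 0 <= f s w)%R -> 0 <= time_integral f.
Proof.
by move=> f0; apply: integral_ge0 => w _; apply: integral_ge0 => s _; rewrite lee_fin.
Qed.

(** The comparison excludes the null endpoint [s = t]: in a convolution the kernel is evaluated
    there at 0, where the available kernel bounds fail. *)
Lemma le_time_integral f g : jointly_measurable f -> jointly_measurable g ->
  (forall s w, 0 <= f s w)%R ->
  (forall s w, (0 <= s < t)%R -> (f s w <= g s w)%R) ->
  (forall s w, 0 <= g s w)%R ->
  time_integral f <= time_integral g.
Proof.
move=> mf mg f0 fg g0; apply: ge0_le_integral => //.
- by move=> w _; apply: integral_ge0 => s _; rewrite lee_fin.
- exact: measurable_time_integral.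
- exact: measurable_time_integral.
- move=> w _; have sub : `[0%R, t[ `<=` I.
    by move=> s /=; rewrite !in_itv/= => /andP[-> /ltW].
  have mfw := jointly_measurable_section w mf.
  have mgw := jointly_measurable_section w mg.
  rewrite -!integral_itv_bndo_bndc; last 2 first.
  + exact: measurable_funS mgw.
  + exact: measurable_funS mfw.
  apply: ge0_le_integral => //.
  + by move=> s _; rewrite lee_fin.
  + exact: measurable_funS mfw.
  + exact: measurable_funS mgw.
  + by move=> s /=; rewrite in_itv/= => st; rewrite lee_fin fg.
Qed.

Lemma time_integralD f g : jointly_measurable f -> jointly_measurable g ->
  (forall s w, 0 <= f s w)%R -> (forall s w, 0 <= g s w)%R ->
  time_integral (fun s w => f s w + g s w)%R = time_integral f + time_integral g.
Proof.
move=> mf mg f0 g0; rewrite /time_integral -ge0_integralD//; last 4 first.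
- by move=> w _; apply: integral_ge0 => s _; rewrite lee_fin.
- exact: measurable_time_integral.
- by move=> w _; apply: integral_ge0 => s _; rewrite lee_fin.
- exact: measurable_time_integral.
apply: eq_integral => w _; rewrite -ge0_integralD//.
- by move=> s _; rewrite lee_fin.
- exact: jointly_measurable_section.
- by move=> s _; rewrite lee_fin.
- exact: jointly_measurable_section.
Qed.

Lemma time_integralZ (c : R) f : (0 <= c)%R -> jointly_measurable f ->
  (forall s w, 0 <= f s w)%R ->
  time_integral (fun s w => c * f s w)%R = c%:E * time_integral f.
Proof.
move=> c0 mf f0; rewrite /time_integral -ge0_integralZl//; last 2 first.
- exact: measurable_time_integral.
- by move=> w _; apply: integral_ge0 => s _; rewrite lee_fin.
apply: eq_integral => w _; rewrite -ge0_integralZl//.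
- exact: jointly_measurable_section.
- by move=> s _; rewrite lee_fin.
Qed.

End time_integrals.

(** * The isometry for finite families of intervals *)

Section step_isometry.
Context {R : realType} {d : nat} {dO : measure_display} {Omega : measurableType dO}.
Variables (P : probability Omega R) (F : R -> set (set Omega)).
Variable W : R -> Omega -> 'cV[R]_d.
Hypotheses (hF : filtration F) (hW : brownian_motion P F W).
Local Notation E f := (Rintegral P setT f).
Local Notation mu := (@lebesgue_measure R).
Local Notation integrable f := (P.-integrable setT (EFin \o f)).
Local Notation c2 := (@gaussian_second_moment R).

Lemma indic_overlap (a c a' c' s : R) :
  \1_(`]a, c] : set R) s * \1_(`]a', c'] : set R) s =
  \1_(`]Num.max a a', Num.min c c'] : set R) s :> R.
Proof.
rewrite -[LHS]/((\1_(`]a, c] : set R) \* \1_(`]a', c'] : set R)) s) -indicI.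
congr (\1_ _ s); apply/seteqP; split=> r /=; rewrite !in_itv/= gt_max le_min.
  by move=> [/andP[-> ->] /andP[-> ->]].
by move=> /andP[/andP[-> ->] /andP[-> ->]].
Qed.

Lemma integrable_indic_overlap t a c a' c' : mu.-integrable `[0, t]
  (EFin \o (fun s : R => \1_(`]a, c] : set R) s * \1_(`]a', c'] : set R) s)).
Proof.
rewrite (_ : (fun s => _) = (\1_(`]Num.max a a', Num.min c c'] : set R) : R -> R)); last first.
  by apply/funext => s; exact: indic_overlap.
apply: (integrableS measurableT) => //.
exact: integrable_indic_itv.
Qed.

Lemma Rintegral_overlap t a c a' c' : 0 <= a -> c <= t ->
  Rintegral mu `[0, t]
    (fun s : R => \1_(`]a, c] : set R) s * \1_(`]a', c'] : set R) s) =
  overlap a c a' c'.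
Proof.
move=> a0 ct; rewrite /Rintegral; under eq_integral do rewrite indic_overlap.
rewrite integral_indic//= setIidl; last first.
  move=> s /=; rewrite !in_itv/= gt_max le_min => /andP[/andP[as_ _] /andP[sc _]].
  by rewrite (le_trans a0 (ltW as_)) (le_trans sc ct).
rewrite lebesgue_measure_itv/= lte_fin /overlap.
set m := Num.max a a'; set M := Num.min c c'.
by case: (ltP m M) => mM; [rewrite max_r// subr_ge0 ltW|rewrite max_l// subr_le0].
Qed.

(** Both sides expand into double sums over pairs of intervals weighted by their overlaps: on the
    left as covariances of increments, on the right as integrals of products of indicators. *)
Lemma step_family_isometry (K : finType) (a c : K -> R)
    (xi : K -> Omega -> 'M[R]_d) (t : R) :
  (forall k, [/\ 0 <= a k, a k <= c k & c k <= t]) ->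
  (forall k, measurable_wrt (F (a k)) (xi k)) ->
  (forall k, exists B, forall w, frob (xi k w) <= B) ->
  (\int[P]_w (frob (\sum_k xi k w *m (W (c k) w - W (a k) w)) ^+ 2)%:E =
   c2%:E * time_integral P t
     (fun s w => frob (\sum_k \1_(`]a k, c k] : set R) s *: xi k w) ^+ 2)%R)%E.
Proof.
move=> act Fxi /choice[B0 xiB0].
pose B := \sum_k `|B0 k|.
have xiB k i j w : `|xi k w i j| <= B.
  apply: (le_trans (entry_frob _ _ _)); apply: (le_trans (xiB0 k w)).
  apply: (le_trans (ler_norm _)); rewrite /B (bigD1 k)//= lerDl.
  by apply: sumr_ge0.
have mxi k i j : measurable_fun setT (fun w => xi k w i j).
  apply: (@measurable_for_measurable _ _ _ _ hF (a k)); first by case: (act k).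
  by move=> ? ?; exact: Fxi.
have ixi k l i j : integrable (fun w => xi k w i j * xi l w i j).
  by apply: integrableM; apply: sq_integrable_bounded => // w; exact: xiB.
(* Row [i] is a scalar sum indexed by pairs of an interval and a coordinate of [W]. *)
have sq i := expect_sqr_incr_sum hF hW (a := fun p : K * 'I_d => a p.1)
  (c := fun p : K * 'I_d => c p.1) snd
  (phi := fun p w => xi p.1 w i p.2) (b := B)
  (fun p => let: And3 h1 h2 _ := act p.1 in conj h1 h2)
  (fun p C mC => Fxi p.1 i p.2 C mC) (fun p w => xiB p.1 i p.2 w).
have lhsE w : frob (\sum_k xi k w *m (W (c k) w - W (a k) w)) ^+ 2 =
    \sum_i (\sum_(p : K * 'I_d) xi p.1 w i p.2 * incr W p.2 (a p.1) (c p.1) w) ^+ 2.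
  rewrite frob_sqr; apply: eq_bigr => i _; rewrite big_ord1; congr (_ ^+ 2).
  rewrite summxE -(pair_bigA _ (fun k j => xi k w i j * incr W j (a k) (c k) w))/=.
  apply: eq_bigr => k _; rewrite mxE; apply: eq_bigr => j _.
  by rewrite !mxE.
have rhsE s w : frob (\sum_k \1_(`]a k, c k] : set R) s *: xi k w) ^+ 2 =
    \sum_i \sum_j \sum_k \sum_l xi k w i j * xi l w i j *
      (\1_(`]a k, c k] : set R) s * \1_(`]a l, c l] : set R) s).
  rewrite frob_sqr; apply: eq_bigr => i _; apply: eq_bigr => j _.
  rewrite summxE expr2 mulr_suml; apply: eq_bigr => k _.
  rewrite mulr_sumr; apply: eq_bigr => l _; rewrite !mxE; ring.
transitivity ((\sum_i E (fun w => (\sum_(p : K * 'I_d)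
    xi p.1 w i p.2 * incr W p.2 (a p.1) (c p.1) w) ^+ 2))%:E).
  rewrite -Rintegral_sum// => [|i]; last by case: (sq i).
  rewrite EFin_Rintegral//; first by apply: eq_integral => w _; rewrite lhsE.
  by apply: integrable_bigsum => // i; case: (sq i).
transitivity (c2%:E * (\int[P]_w (\sum_i \sum_j \sum_k \sum_l
   overlap (a k) (c k) (a l) (c l) * (xi k w i j * xi l w i j))%:E))%E; last first.
  congr (_ * _)%E; apply: eq_integral => w _.
  under [RHS]eq_integral do rewrite rhsE.
  have mI : measurable (`[0, t] : set (measurableTypeR R)) by exact: measurable_itv.
  have iI k l i j : mu.-integrable `[0, t] (EFin \o (fun s : R => xi k w i j * xi l w i j *
      (\1_(`]a k, c k] : set R) s * \1_(`]a l, c l] : set R) s))).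
    by apply: integrable_mull => //; exact: integrable_indic_overlap.
  rewrite -EFin_Rintegral//; last first.
    do 3 (apply: integrable_bigsum => // ?); apply: integrable_bigsum => // ?; exact: iI.
  congr EFin.
  rewrite Rintegral_sum// => [|i]; last first.
    do 2 (apply: integrable_bigsum => // ?); apply: integrable_bigsum => // ?; exact: iI.
  apply: eq_bigr => i _; rewrite Rintegral_sum// => [|j]; last first.
    apply: integrable_bigsum => // ?; apply: integrable_bigsum => // ?; exact: iI.
  apply: eq_bigr => j _; rewrite Rintegral_sum// => [|k]; last first.
    apply: integrable_bigsum => // ?; exact: iI.
  apply: eq_bigr => k _; rewrite Rintegral_sum//.
  apply: eq_bigr => l _; rewrite Rintegral_mull//; last exact: integrable_indic_overlap.
  by rewrite Rintegral_overlap 1?mulrC//; case: (act k).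
have iO k l i j : integrable (fun w => overlap (a k) (c k) (a l) (c l) *
    (xi k w i j * xi l w i j)).
  exact: integrable_mull.
rewrite -EFin_Rintegral//; last first.
  do 3 (apply: integrable_bigsum => // ?); apply: integrable_bigsum => // ?; exact: iO.
rewrite -EFinM; congr EFin.
rewrite Rintegral_sum// => [|i]; last first.
  do 2 (apply: integrable_bigsum => // ?); apply: integrable_bigsum => // ?; exact: iO.
rewrite mulr_sumr; apply: eq_bigr => i _; case: (sq i) => _ ->; congr (_ * _).
rewrite Rintegral_sum// => [|j]; last first.
  apply: integrable_bigsum => // ?; apply: integrable_bigsum => // ?; exact: iO.
rewrite -(pair_bigA _ (fun k j => \sum_(q : K * 'I_d)
  (j == q.2)%:R * overlap (a k) (c k) (a q.1) (c q.1) *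
     E (fun w => xi k w i j * xi q.1 w i q.2)))/= exchange_big/=.
apply: eq_bigr => j _; rewrite Rintegral_sum// => [|k]; last first.
  apply: integrable_bigsum => // ?; exact: iO.
apply: eq_bigr => k _; rewrite Rintegral_sum//.
rewrite -(pair_bigA _ (fun l j' => (j == j')%:R * overlap (a k) (c k) (a l) (c l) *
     E (fun w => xi k w i j * xi l w i j')))/=.
(* Distinct coordinates are uncorrelated, so only [j] itself survives. *)
apply: eq_bigr => l _; rewrite (bigD1 j)//= eqxx mul1r big1 ?addr0.
  by rewrite Rintegral_mull.
by move=> j' /negbTE j'j; rewrite eq_sym j'j !mul0r.
Qed.

End step_isometry.

(** * Comparison of Ito integrals *)

Section ito_comparison.
Context {R : realType} {d : nat} {dO : measure_display} {Omega : measurableType dO}.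
Variables (P : probability Omega R) (F : R -> set (set Omega)).
Variable W : R -> Omega -> 'cV[R]_d.
Hypotheses (hF : filtration F) (hW : brownian_motion P F W).
Local Notation c2 := (@gaussian_second_moment R).
Implicit Types (S : step_process R Omega d).

Lemma step_time_ge0 S k : adapted_step F S -> (k <= step_size S)%N ->
  0 <= step_time S k.
Proof.
move=> [S0 hS]; elim: k => [//|k ih] kS.
by case: (hS k kS) => tk _ _; exact: le_trans (ih (ltnW kS)) tk.
Qed.

(** Stopping at [t] shrinks an interval beyond [t] to a point, but its coefficient need not be known
    at time [t]. Replacing it by 0 changes neither the integral nor the values up to [t], and
    restores adaptedness. *)
Definition stopped_coef S t k w : 'M[R]_d :=
  if step_time S k <= t then step_coef S k w else 0.

Lemma step_integralE S t w : adapted_step F S ->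
  step_integral W S t w = \sum_(k < step_size S) stopped_coef S t k w *m
    (W (Num.min (step_time S k.+1) t) w - W (Num.min (step_time S k) t) w).
Proof.
move=> [_ hS]; apply: eq_bigr => k _; rewrite /stopped_coef.
case: ifPn => //; rewrite -ltNge => /ltW tk.
case: (hS k (ltn_ord k)) => tkk _ _.
by rewrite !min_r ?subrr ?mulmx0// (le_trans tk).
Qed.

Lemma step_valE S t s w : s <= t -> step_val S s w =
  \sum_(k < step_size S)
    \1_(`]Num.min (step_time S k) t, Num.min (step_time S k.+1) t] : set R) s
      *: stopped_coef S t k w.
Proof.
move=> st; apply: eq_bigr => k _; rewrite /stopped_coef !indicE !mem_setE !in_itv/=.
rewrite gt_min le_min st andbT (ltNge t s) st orbF.
case: ifPn => //; rewrite -ltNge => tk.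
have -> : (step_time S k < s) = false.
  by apply/negbTE; rewrite -leNgt ltW// (le_lt_trans st).
by rewrite !scale0r.
Qed.

Lemma stopped_coef_adapted S t k : 0 <= t -> adapted_step F S -> (k < step_size S)%N ->
  measurable_wrt (F (Num.min (step_time S k) t)) (stopped_coef S t k).
Proof.
move=> t0 aS kS; have [_ /(_ k kS)[_ mk _]] := aS.
have [tk|tk] := boolP (step_time S k <= t).
  rewrite (_ : stopped_coef S t k = step_coef S k) ?min_l//.
  by apply/funext => w; rewrite /stopped_coef tk.
rewrite (_ : stopped_coef S t k = cst 0); last first.
  by apply/funext => w; rewrite /stopped_coef (negbTE tk).
move=> i j B mB.
rewrite min_r; last by rewrite ltW// ltNge.
have [F0 FC _] := filtration_sigma hF t0.
rewrite (_ : _ @^-1` B = (fun=> (0 : 'M[R]_d) i j) @^-1` B)//.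
have [B0|B0] := pselect (B ((0 : 'M[R]_d) i j)).
  rewrite (_ : _ @^-1` _ = setT `\` set0); first exact: FC.
  by apply/seteqP; split=> // w _; split.
by rewrite (_ : _ @^-1` _ = set0)//; apply/seteqP; split.
Qed.

(** The two processes form a single family over the disjoint sum of their index sets, with opposite
    signs. As overlaps are allowed, no common refinement of the partitions is formed. *)
Lemma step_difference_isometry S S' t : 0 <= t ->
  adapted_step F S -> adapted_step F S' ->
  (\int[P]_w (frob (step_integral W S' t w - step_integral W S t w) ^+ 2)%:E =
   c2%:E * time_integral P t
     (fun s w => frob (step_val S' s w - step_val S s w) ^+ 2)%R)%E.
Proof.
move=> t0 aS aS'.
pose K := ('I_(step_size S') + 'I_(step_size S))%type.
pose a (k : K) := match k with
  | inl k => Num.min (step_time S' k) t | inr k => Num.min (step_time S k) t end.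
pose c (k : K) := match k with
  | inl k => Num.min (step_time S' k.+1) t | inr k => Num.min (step_time S k.+1) t end.
pose xi (k : K) w := match k with
  | inl k => stopped_coef S' t k w | inr k => - stopped_coef S t k w end.
have min_bounds S1 (k : 'I_(step_size S1)) : adapted_step F S1 ->
    [/\ 0 <= Num.min (step_time S1 k) t,
        Num.min (step_time S1 k) t <= Num.min (step_time S1 k.+1) t
      & Num.min (step_time S1 k.+1) t <= t].
  move=> aS1; case: (aS1) => _ /(_ k (ltn_ord k))[tk _ _]; split.
  - by rewrite le_min t0 andbT; apply: step_time_ge0 => //; exact: ltnW.
  - by rewrite le_min !ge_min tk lexx orbT.
  - by rewrite ge_min lexx orbT.
have bnd S1 (k : 'I_(step_size S1)) : adapted_step F S1 ->
    exists B, forall w, frob (stopped_coef S1 t k w) <= B.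
  case=> _ /(_ k (ltn_ord k))[_ _ [B hB]]; exists (Num.max B 0) => w.
  by rewrite /stopped_coef; case: ifP => _; rewrite ?frob0 le_max ?hB ?lexx ?orbT.
have := @step_family_isometry R d dO Omega P F W hF hW K a c xi t.
have -> : (\int[P]_w (frob (\sum_k xi k w *m (W (c k) w - W (a k) w)) ^+ 2)%:E =
  \int[P]_w (frob (step_integral W S' t w - step_integral W S t w) ^+ 2)%:E)%E.
  apply: eq_integral => w _; congr (frob _ ^+ 2)%:E.
  rewrite !step_integralE// big_sumType/= -sumrN; congr (_ + _).
  by apply: eq_bigr => k _; rewrite mulNmx.
have -> : (time_integral P t
     (fun s w => frob (\sum_k \1_(`]a k, c k] : set R) s *: xi k w) ^+ 2)%R =
  time_integral P t (fun s w => frob (step_val S' s w - step_val S s w) ^+ 2)%R)%E.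
  apply: eq_integral => w _; apply: eq_integral => s.
  rewrite inE/= in_itv/= => /andP[s0 st].
  congr (frob _ ^+ 2)%:E; rewrite !(step_valE _ _ st) big_sumType/= -sumrN; congr (_ + _).
  by apply: eq_bigr => k _; rewrite scalerN.
apply.
- by case=> k; exact: min_bounds.
- case=> k; first exact: stopped_coef_adapted.
  have ta : 0 <= a (inr k) by case: (min_bounds S k aS).
  move=> i j B mB /=.
  have sF := filtration_sigma hF ta.
  have /(_ i j) := stopped_coef_adapted t0 aS (ltn_ord k).
  move=> mk.
  have : measurable_for (F (a (inr k))) (fun w => - stopped_coef S t k w i j).
    apply/(measurable_forP _ sF); apply: measurable_funN.
    by apply/(measurable_forP _ sF).
  move=> /(_ B mB); congr (F _ _); apply/seteqP; split=> w /=; by rewrite mxE.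
- case=> k; first exact: bnd.
  by have [B hB] := bnd S k aS; exists B => w; rewrite /xi -[- _]sub0r frob_distC subr0.
Qed.

Lemma measurable_step_integral S t : 0 <= t -> adapted_step F S ->
  measurable_mx setT (step_integral W S t).
Proof.
move=> t0 aS; rewrite (_ : step_integral W S t = fun w => \sum_(k < step_size S)
    stopped_coef S t k w *m
    (W (Num.min (step_time S k.+1) t) w - W (Num.min (step_time S k) t) w)); last first.
  by apply/funext => w; exact: step_integralE.
have mW u : 0 <= u -> measurable_mx setT (W u).
  move=> u0 i j; apply: (measurable_for_measurable hF u0) => B mB.
  by case: hW => mW _ _ _; exact: mW.
apply: measurable_mx_sum => k; apply: measurable_mxM.
  move=> i j; apply: (@measurable_for_measurable _ _ _ _ hF (Num.min (step_time S k) t)).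
    by rewrite le_min t0 andbT; apply: step_time_ge0 => //; exact: ltnW.
  by move=> B mB; exact: (stopped_coef_adapted t0 aS (ltn_ord k)).
apply: measurable_mxB; apply: mW; rewrite le_min t0 andbT;
  by apply: step_time_ge0 => //; exact: ltnW.
Qed.

Lemma jointly_measurable_step_val S t : adapted_step F S ->
  measurable_mx ((`[0, t] : set (measurableTypeR R)) `*` [set: Omega])
    (fun p : measurableTypeR R * Omega => step_val S p.1 p.2).
Proof.
move=> aS; apply: measurable_mx_sum => k; apply: measurable_mxZ.
  apply: measurable_funTS; apply: (@measurableT_comp _ _ _ _ _ _ (\1_(_ : set R) : R -> R)).
    exact: measurable_indic.
  exact: measurable_fst.
move=> i j; apply: measurable_funTS.
apply: (@measurableT_comp _ _ _ _ _ _ (fun w => step_coef S k w i j)); last exact: measurable_snd.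
apply: (@measurable_for_measurable _ _ _ _ hF (step_time S k)).
  by apply: step_time_ge0 => //; exact: ltnW.
by case: aS => _ /(_ k (ltn_ord k))[_ mk _] B mB; exact: mk.
Qed.

(** Distributivity over extended reals is used for nonnegative terms only, hence the sign
    conditions. *)
Let ito_rearrange (c : R) (e e' x y q : \bar R) : 0 <= c ->
  (0 <= e -> 0 <= e' -> 0 <= x -> 0 <= y -> 0 <= q ->
  3%:E * (e' + c%:E * (3%:E * (x + q + y)) + e) =
  3%:E * (e + e') + (9 * c)%:E * (y + x) + (9 * c)%:E * q)%E.
Proof.
move=> c0 e0 e'0 x0 y0 q0.
have xy0 : (0 <= y + x)%E by exact: adde_ge0.
have xyq0 : (0 <= y + x + q)%E by exact: adde_ge0.
rewrite (addeAC x q y) [(x + y)%E]addeC (addeAC e') [(e' + e)%E]addeC.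
rewrite ge0_muleDr; [|exact: adde_ge0|by rewrite !mule_ge0// lee_fin].
rewrite -[RHS]addeA; congr (_ + _)%E; rewrite -ge0_muleDr//.
by rewrite !muleA -!EFinM; congr (_%:E * _)%E; ring.
Qed.

Let ito_error_cvg (c : R) (e e' x y : nat -> \bar R) :
  e @ \oo --> 0%E -> e' @ \oo --> 0%E -> x @ \oo --> 0%E -> y @ \oo --> 0%E ->
  (fun n => 3%:E * (e n + e' n) + c%:E * (x n + y n))%E @ \oo --> 0%E.
Proof.
move=> e0 e'0 x0 y0.
rewrite -[0%E](_ : 3%:E * (0 + 0) + c%:E * (0 + 0) = 0)%E; last first.
  by rewrite !adde0 !mule0 adde0.
apply: cvgeD; first by rewrite adde0 !mule0.
  by apply: cvgeZl => //; apply: cvgeD.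
by apply: cvgeZl => //; apply: cvgeD.
Qed.

(* The two uses of [|x + y + z|^2 <= 3 (|x|^2 + |y|^2 + |z|^2)] that lead to the
   constant 9 spare the identification of the limits of the isometry. *)
Lemma is_ito_difference t (H H' : R -> Omega -> 'M[R]_d) (Y Y' : Omega -> 'cV[R]_d) :
  0 <= t -> is_ito P F W t H Y -> is_ito P F W t H' Y' ->
  measurable_mx ((`[0, t] : set (measurableTypeR R)) `*` [set: Omega])
    (fun p : measurableTypeR R * Omega => H p.1 p.2) ->
  measurable_mx ((`[0, t] : set (measurableTypeR R)) `*` [set: Omega])
    (fun p : measurableTypeR R * Omega => H' p.1 p.2) ->
  (\int[P]_w (frob (Y' w - Y w) ^+ 2)%:E <=
   (9 * c2)%:E * time_integral P t (fun s w => frob (H' s w - H s w) ^+ 2)%R)%E.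
Proof.
move=> t0 [mY [S [aS SH SY]]] [mY' [S' [aS' SH' SY']]] mH mH'.
have c20 := @gaussian_second_moment_ge0 R.
have sq0 m n (A : 'M[R]_(m, n)) : 0 <= frob A ^+ 2 by exact: sqr_ge0.
have {}mY : measurable_mx setT Y by move=> i j _ B mB; rewrite setTI; exact: mY.
have {}mY' : measurable_mx setT Y' by move=> i j _ B mB; rewrite setTI; exact: mY'.
pose Q := time_integral P t (fun s w => frob (H' s w - H s w) ^+ 2)%R.
pose e n := (\int[P]_w (frob (Y w - step_integral W (S n) t w) ^+ 2)%:E)%E.
pose e' n := (\int[P]_w (frob (Y' w - step_integral W (S' n) t w) ^+ 2)%:E)%E.
pose de n := time_integral P t (fun s w => frob (H s w - step_val (S n) s w) ^+ 2)%R.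
pose de' n := time_integral P t (fun s w => frob (H' s w - step_val (S' n) s w) ^+ 2)%R.
(* Collects the approximation errors, which tend to 0. *)
pose u n := (3%:E * (e n + e' n) + (9 * c2)%:E * (de n + de' n))%E.
have bound n : (\int[P]_w (frob (Y' w - Y w) ^+ 2)%:E <= u n + (9 * c2)%:E * Q)%E.
  have mS := measurable_step_integral t0 (aS n).
  have mS' := measurable_step_integral t0 (aS' n).
  have mV := @jointly_measurable_step_val _ t (aS n).
  have mV' := @jointly_measurable_step_val _ t (aS' n).
  have mfr (f g : Omega -> 'cV[R]_d) : measurable_mx setT f -> measurable_mx setT g ->
      measurable_fun setT (fun w => (frob (f w - g w) ^+ 2)%:E).
    by move=> mf mg; apply/measurable_EFinP/measurable_frob_sqr/measurable_mxB.
  have mfj (f g : R -> Omega -> 'M[R]_d) :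
      measurable_mx ((`[0, t] : set (measurableTypeR R)) `*` [set: Omega])
        (fun p : measurableTypeR R * Omega => f p.1 p.2) ->
      measurable_mx ((`[0, t] : set (measurableTypeR R)) `*` [set: Omega])
        (fun p : measurableTypeR R * Omega => g p.1 p.2) ->
      jointly_measurable t (fun s w => frob (f s w - g s w) ^+ 2).
    by move=> mf mg; apply/measurable_frob_sqr/measurable_mxB.
  (* From [Y] to [Y'] through the two step integrals. The isometry turns the middle leg into a
     distance of step processes, which is split again through [H] and [H']. *)
  apply: (@le_trans _ _ (\int[P]_w (3%:E * ((frob (Y' w - step_integral W (S' n) t w) ^+ 2)%:E
      + (frob (step_integral W (S' n) t w - step_integral W (S n) t w) ^+ 2)%:E
      + (frob (Y w - step_integral W (S n) t w) ^+ 2)%:E)))%E).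
    apply: ge0_le_integral => //.
    - by move=> w _; rewrite lee_fin.
    - exact: mfr.
    - by apply: measurable_funeM; do 2 (apply: emeasurable_funD; last exact: mfr); exact: mfr.
    - move=> w _; rewrite -!EFinD -EFinM lee_fin.
      rewrite [in leRHS](frob_distC (Y w)).
      apply: le_trans (frob_sqr_tr3 _ _ _).
      by rewrite !addrA !subrK.
  rewrite ge0_integralZl//; last 2 first.
  - by do 2 (apply: emeasurable_funD; last exact: mfr); exact: mfr.
  - by move=> w _; rewrite !adde_ge0// lee_fin.
  rewrite ge0_integralD//; last 4 first.
  - by move=> w _; rewrite adde_ge0// lee_fin.
  - by apply: emeasurable_funD; exact: mfr.
  - by move=> w _; rewrite lee_fin.
  - exact: mfr.
  rewrite ge0_integralD//; last 4 first.
  - by move=> w _; rewrite lee_fin.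
  - exact: mfr.
  - by move=> w _; rewrite lee_fin.
  - exact: mfr.
  rewrite step_difference_isometry// -/(e n) -/(e' n).
  have step_le : (time_integral P t (fun s w => frob (step_val (S' n) s w - step_val (S n) s w) ^+ 2)%R
      <= 3%:E * (de' n + Q + de n))%E.
    apply: (@le_trans _ _ (time_integral P t (fun s w => 3 * (frob (H' s w - step_val (S' n) s w) ^+ 2
      + frob (H' s w - H s w) ^+ 2 + frob (H s w - step_val (S n) s w) ^+ 2))%R)).
      apply: le_time_integral => //.
      - exact: mfj.
      - apply: measurable_funM => //; do 2 (apply: measurable_funD; last exact: mfj); exact: mfj.
      - move=> s w _; rewrite [in leRHS](frob_distC (H' s w) (step_val _ _ _)).
        apply: le_trans (frob_sqr_tr3 _ _ _).
        by rewrite !addrA !subrK.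
      - by move=> s w; rewrite mulr_ge0// !addr_ge0.
    rewrite time_integralZ//; last 2 first.
    - do 2 (apply: measurable_funD; last exact: mfj); exact: mfj.
    - by move=> s w; rewrite !addr_ge0.
    rewrite time_integralD//; last 3 first.
    - apply: measurable_funD; exact: mfj.
    - exact: mfj.
    - by move=> s w; rewrite addr_ge0.
    rewrite time_integralD//; last 2 first.
    - exact: mfj.
    - exact: mfj.
  have e0 : (0 <= e n)%E by apply: integral_ge0 => w _; rewrite lee_fin.
  have e'0 : (0 <= e' n)%E by apply: integral_ge0 => w _; rewrite lee_fin.
  have de0 : (0 <= de n)%E by exact: time_integral_ge0.
  have de'0 : (0 <= de' n)%E by exact: time_integral_ge0.
  have Q0 : (0 <= Q)%E by exact: time_integral_ge0.
  apply: (@le_trans _ _ (3%:E * (e' n + c2%:E * (3%:E * (de' n + Q + de n)) + e n))%E).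
    rewrite lee_wpmul2l// leeD2r// leeD2l// lee_wpmul2l//.
  by rewrite (ito_rearrange c20 e0 e'0 de'0 de0 Q0).
have cvg_e : e @ \oo --> 0%E.
  by move: SY; rewrite unlock.
have cvg_e' : e' @ \oo --> 0%E.
  by move: SY'; rewrite unlock.
have u0 : u @ \oo --> 0%E by exact: ito_error_cvg cvg_e cvg_e' SH SH'.
have cu : (fun n => u n + (9 * c2)%:E * Q)%E @ \oo --> ((9 * c2)%:E * Q)%E.
  rewrite -[X in _ --> X]add0e; apply: cvgeD => //; last exact: cvg_cst.
by apply: (cvge_ge _ cu); exact: nearW.
Qed.

End ito_comparison.

(** * The kernels *)

(** Monotonicity is asked on [D] only, because [fine (Gbar lambda t)] drops to 0 wherever [Gbar] is
    infinite and so may fail to be monotone on the line. *)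
Lemma nonincreasing_in_measurable (R : realType) (D : set R) (f : R -> R) :
  is_interval D -> {in D &, {homo f : x y / x <= y >-> y <= x}} ->
  measurable_fun D f.
Proof.
move=> iD fD; apply: (measurability (@RGenCInfty.G R)) => [|/= _ [_] [r] -> <-].
  exact: RGenCInfty.measurableE.
apply: is_interval_measurable => s t/= [Ds fs] [Dt ft] u su.
have Du : D u by exact: iD su.
split => //; move: fs ft su; rewrite !in_itv/= !andbT => fs ft /andP[_ ut].
by rewrite (le_trans ft)// fD// inE.
Qed.

Section kernels.
Context {R : realType} {d : nat}.
Variable lambda : {measure set (measurableTypeR R) -> \bar R}.
Hypothesis Gbar_fin : forall t : R, 0 < t -> (Gbar lambda t < +oo)%E.

Lemma measurable_exp_weight (D : set (measurableTypeR R)) (t : R) :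
  measurable_fun D (fun rho => expR (- (rho * t))).
Proof.
apply: measurable_funTS; apply: measurableT_comp => //.
by apply: measurableT_comp => //; exact: measurable_funM.
Qed.

Lemma Gbar_ge0 t : (0 <= Gbar lambda t)%E.
Proof. by apply: integral_ge0 => rho _; rewrite lee_fin expR_ge0. Qed.

Lemma Gbar_nonincreasing s t : s <= t -> (Gbar lambda t <= Gbar lambda s)%E.
Proof.
move=> st; apply: ge0_le_integral => //.
- by apply/measurable_EFinP; exact: measurable_exp_weight.
- by apply/measurable_EFinP; exact: measurable_exp_weight.
- move=> rho /=; rewrite in_itv/= andbT => rho0.
  by rewrite lee_fin ler_expR lerN2 ler_wpM2l.
Qed.

(** On [[0, K[] the exponential in [Gbar lambda 1] is at least [e^(-K)]. *)
Lemma truncated_mass_fin K : (lambda `[0%R, K[%classic < +oo)%E.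
Proof.
have : ((expR (- K))%:E * lambda `[0%R, K[%classic < +oo)%E.
  apply: le_lt_trans (Gbar_fin ltr01).
  rewrite -(integral_cst lambda (measurable_itv `[0%R, K[) (expR (- K))%:E).
  apply: (@le_trans _ _ (\int[lambda]_(rho in `[0%R, K[) (expR (- (rho * 1)))%:E)%E).
    apply: ge0_le_integral => //.
    - by move=> rho _; rewrite lee_fin expR_ge0.
    - by apply/measurable_EFinP; exact: measurable_exp_weight.
    - move=> rho /=; rewrite in_itv/= => /andP[_ rhoK].
      by rewrite lee_fin ler_expR lerN2 mulr1 ltW.
  apply: ge0_subset_integral => //.
  - by apply/measurable_EFinP; exact: measurable_exp_weight.
  - by move=> rho; rewrite /= !in_itv/= => /andP[->].
case: (lambda _) => [r _||]; first by rewrite ltry.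
  by rewrite gt0_muley ?lte_fin ?expR_gt0.
by [].
Qed.

Variable M : R -> 'M[R]_d.
Hypothesis bM : bounded_measurable M.

Lemma frob_supnorm rho : 0 <= rho -> frob (M rho) <= supnorm M.
Proof.
move=> rho0; apply: ub_le_sup; first by case: bM.
by exists rho => //=; rewrite in_itv/= rho0.
Qed.

Lemma supnorm_ge0 : 0 <= supnorm M.
Proof. exact: le_trans (frob_ge0 _) (frob_supnorm (lexx 0)). Qed.

Let entry_le i j rho : 0 <= rho -> `|M rho i j| <= supnorm M.
Proof. by move=> rho0; rewrite (le_trans (entry_frob _ _ _))// frob_supnorm. Qed.

Let IK K := `[0%R, K[%classic : set (measurableTypeR R).

Lemma integrable_weighted (K t b : R) (f : R -> R) :
  measurable_fun (IK K) f -> (forall rho, 0 <= rho -> `|f rho| <= b) ->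
  lambda.-integrable (IK K) (EFin \o (fun rho => expR (- (rho * t)) * f rho)).
Proof.
move=> mf fb; apply: measurable_bounded_integrable.
- exact: measurable_itv.
- exact: truncated_mass_fin.
- by apply: measurable_funM => //; exact: measurable_exp_weight.
(* The sign of [t] is arbitrary here; for [t < 0] the weight grows up to [e^(K |t|)]. *)
- exists (expR (K * `|t|) * b); split; first exact: num_real.
  move=> x bx rho; rewrite /IK/= in_itv/= => /andP[rho0 rhoK].
  rewrite (le_trans _ (ltW bx))// normrM ler_pM//; last exact: fb.
  rewrite ger0_norm ?expR_ge0// ler_expR -mulrN.
  rewrite (le_trans (ler_norm _))// normrM normrN ger0_norm// ler_wpM2r// ltW//.
Qed.

Let mM K i j : measurable_fun (IK K) (fun rho => M rho i j).
Proof.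
case: bM => mM _; apply: measurable_funS (mM i j) => //.
by move=> rho; rewrite /IK/= !in_itv/= => /andP[->].
Qed.

(** Enlarging [[0, K[] to the half-line makes the bound independent of [K]. *)
Lemma truncated_kernel_entry_le K t i j : 0 < t ->
  `|truncated_kernel lambda M K t i j| <= supnorm M * fine (Gbar lambda t).
Proof.
move=> t0; rewrite mxE.
have iM := integrable_weighted t (@mM K i j) (@entry_le i j).
have mIK : measurable (IK K) by exact: measurable_itv.
rewrite -lee_fin EFin_normr_Rintegral//.
rewrite EFinM fineK; last by rewrite ge0_fin_numE ?Gbar_ge0// Gbar_fin.
apply: (le_trans (le_abse_integral _ mIK (measurable_int _ iM))).
rewrite /Gbar -ge0_integralZl//; last 2 first.
- by apply/measurable_EFinP; exact: measurable_exp_weight.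
- by rewrite lee_fin supnorm_ge0.
apply: (@le_trans _ _ (\int[lambda]_(rho in IK K)
    ((supnorm M)%:E * (expR (- (rho * t)))%:E))%E).
  apply: ge0_le_integral => //.
  - by apply: measurableT_comp => //; exact: measurable_int iM.
  - by apply: measurable_funeM; apply/measurable_EFinP; exact: measurable_exp_weight.
  - move=> rho; rewrite /IK/= in_itv/= => /andP[rho0 _].
    rewrite -EFinM lee_fin normrM ger0_norm ?expR_ge0// mulrC.
    by rewrite ler_wpM2r ?expR_ge0// entry_le.
apply: ge0_subset_integral => //.
- by apply: measurable_funeM; apply/measurable_EFinP; exact: measurable_exp_weight.
- by move=> rho _; rewrite -EFinM lee_fin mulr_ge0 ?expR_ge0// supnorm_ge0.
- by move=> rho; rewrite /IK/= !in_itv/= => /andP[->].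
Qed.

Lemma truncated_kernel_sqr_le K t : 0 < t ->
  frob (truncated_kernel lambda M K t) ^+ 2 <=
  (d * d)%:R * supnorm M ^+ 2 * fine (Gbar lambda t) ^+ 2.
Proof.
move=> t0; rewrite -mulrA -exprMn; apply: frob_sqr_entries => i j.
exact: truncated_kernel_entry_le.
Qed.

(* The positive and the negative part of an entry of [M] each contribute a
   nonincreasing function of [t]. *)
Lemma truncated_kernel_measurable K T : kernel_measurable T (truncated_kernel lambda M K).
Proof.
move=> i j; pose p rho := Num.max (M rho i j) 0; pose n rho := Num.max (- M rho i j) 0.
have mIK : measurable (IK K) by exact: measurable_itv.
have part_le (x : R) : `|Num.max x 0| <= `|x|.
  by case: (leP x 0) => _; rewrite ?normr0.
have mp : measurable_fun (IK K) p by exact: measurable_maxr.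
have mn : measurable_fun (IK K) n.
  by apply: measurable_maxr => //; exact: measurable_funN.
have pb rho : 0 <= rho -> `|p rho| <= supnorm M.
  by move=> rho0; rewrite (le_trans (part_le _))// entry_le.
have nb rho : 0 <= rho -> `|n rho| <= supnorm M.
  by move=> rho0; rewrite (le_trans (part_le _))// normrN entry_le.
pose A (f : R -> R) (t : R) : R := Rintegral lambda (IK K) (fun rho => expR (- (rho * t)) * f rho).
have mA (f : R -> R) : measurable_fun (IK K) f -> (forall rho, 0 <= rho -> `|f rho| <= supnorm M) ->
    (forall rho, 0 <= f rho) -> measurable_fun [set: measurableTypeR R] (A f).
  move=> mf fb f0; apply: nonincreasing_measurable => // s t st.
  apply: le_Rintegral => //; [exact: integrable_weighted fb|exact: integrable_weighted fb|].
  move=> rho; rewrite /IK/= in_itv/= => /andP[rho0 _].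
  by rewrite ler_wpM2r// ler_expR lerN2 ler_wpM2l.
rewrite (_ : (fun t => _) = (fun t => A p t - A n t)).
  apply: measurable_funTS; apply: measurable_funB; apply: mA => //.
    by move=> rho; rewrite le_max lexx orbT.
  by move=> rho; rewrite le_max lexx orbT.
apply/funext => t; rewrite mxE /A -RintegralB//.
- apply: eq_Rintegral => rho _; rewrite -mulrBr; congr (_ * _).
  by rewrite /p /n; case: (leP (M rho i j) 0) => h; case: (leP (- M rho i j) 0) => h'; lra.
- exact: integrable_weighted pb.
- exact: integrable_weighted nb.
Qed.

End kernels.

(** * An integrable majorant independent of [K] *)

Section dominating_kernel.
Context {R : realType}.
Variable lambda : {measure set (measurableTypeR R) -> \bar R}.
Hypothesis Gbar_fin : forall t : R, 0 < t -> (Gbar lambda t < +oo)%E.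
Variables (T : R) (Dbar : R -> R).
Hypothesis Gbar_L2 :
  (\int[lebesgue_measure]_(t in `[0%R, T]) (Gbar lambda t ^+ 2) < +oo)%E.
Hypothesis Dbar_meas : measurable_fun (`[0, T] : set (measurableTypeR R)) Dbar.
Hypothesis Dbar_L2 :
  (\int[lebesgue_measure]_(t in `[0%R, T]) (Dbar t ^+ 2)%:E < +oo)%E.
Local Notation mu := (@lebesgue_measure R).

(** The value at 0 is set to 0, as [Gbar] may be infinite there, and the extension by 0 gives the
    integrable function on the line, supported in [s > 0], that Gronwall's lemma takes. *)
Definition dominating_kernel : R -> R :=
  (fun t => Dbar t ^+ 2 + fine (Gbar lambda t) ^+ 2) \_ `]0, T].

Lemma dominating_kernel_ge0 t : 0 <= dominating_kernel t.
Proof. by rewrite /dominating_kernel patchE; case: ifP => // _; rewrite addr_ge0 ?sqr_ge0. Qed.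

Lemma dominating_kernel_supp t : t <= 0 -> dominating_kernel t = 0.
Proof.
move=> t0; rewrite /dominating_kernel patchE ifF//; apply/negP.
by rewrite inE/= in_itv/= ltNge t0.
Qed.

Lemma dominating_kernelE t : 0 < t <= T ->
  dominating_kernel t = Dbar t ^+ 2 + fine (Gbar lambda t) ^+ 2.
Proof. by move=> tT; rewrite /dominating_kernel patchE ifT// inE/= in_itv. Qed.

Let J : set (measurableTypeR R) := `]0%R, T]%classic.

Let mJ : measurable J. Proof. exact: measurable_itv. Qed.

Let JI : J `<=` `[0, T].
Proof. by move=> t; rewrite /J/= !in_itv/= => /andP[/ltW -> ->]. Qed.

Let mD : measurable_fun J Dbar.
Proof. exact: measurable_funS Dbar_meas. Qed.

Let mG : measurable_fun J (fun t => fine (Gbar lambda t)).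
Proof.
apply: nonincreasing_in_measurable; first exact: interval_is_interval.
move=> s t; rewrite !inE /J/= !in_itv/= => /andP[s0 _] /andP[t0 _] st.
by apply: fine_le; rewrite ?ge0_fin_numE ?Gbar_ge0 ?Gbar_fin// Gbar_nonincreasing.
Qed.

Lemma dominating_kernel_integrable :
  mu.-integrable [set: measurableTypeR R] (EFin \o dominating_kernel).
Proof.
have -> : EFin \o dominating_kernel =
    (fun t => (Dbar t ^+ 2 + fine (Gbar lambda t) ^+ 2)%:E) \_ J.
  by apply/funext => t /=; rewrite /dominating_kernel !patchE; case: ifP.
apply/(integrable_mkcond _ mJ).1.
have mD2 : measurable_fun J (fun t => (Dbar t ^+ 2)%:E).
  by apply/measurable_EFinP; exact: measurable_funX.
have mG2 : measurable_fun J (fun t => (fine (Gbar lambda t) ^+ 2)%:E).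
  by apply/measurable_EFinP; exact: measurable_funX.
apply: (@integrable_addr _ _ _ mu J mJ (fun t => Dbar t ^+ 2)
  (fun t => fine (Gbar lambda t) ^+ 2)); apply/integrableP; split => //.
  under eq_integral do rewrite /= ger0_norm ?sqr_ge0//.
  apply: le_lt_trans Dbar_L2; apply: ge0_subset_integral => //.
  - by apply/measurable_EFinP; exact: measurable_funX.
  - by move=> t _; rewrite lee_fin sqr_ge0.
under eq_integral do rewrite /= ger0_norm ?sqr_ge0//.
have fineG t : 0 < t -> (fine (Gbar lambda t) ^+ 2)%:E = (Gbar lambda t ^+ 2)%E.
  by move=> t0; rewrite EFin_expe fineK// ge0_fin_numE ?Gbar_ge0 ?Gbar_fin.
apply: le_lt_trans Gbar_L2.
rewrite -[leRHS]integral_itv_obnd_cbnd.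
  rewrite le_eqVlt; apply/orP; left; apply/eqP; apply: eq_integral => t.
  rewrite inE /J/= in_itv/= => /andP[t0 _].
  exact: fineG.
apply: (eq_measurable_fun _ _ mG2) => t; rewrite inE /J/= in_itv/= => /andP[t0 _].
exact: fineG.
Qed.

End dominating_kernel.

(** * Comparison of Volterra equations *)

Section time_changes.
Context {R : realType} {dO : measure_display} {Omega : measurableType dO}.
Local Notation mu := (@lebesgue_measure R).
Local Notation I t := (`[0%R, t]%classic : set (measurableTypeR R)).

Lemma integral_reflect_itv t (g : R -> R) : measurable_fun (I t) g ->
  (forall s, 0 <= g s) ->
  (\int[mu]_(s in I t) (g (t - s))%:E = \int[mu]_(s in I t) (g s)%:E)%E.
Proof.
move=> mg g0; have mI : measurable (I t) by exact: measurable_itv.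
rewrite [RHS]integral_mkcond -(@integral_reflect R t).
- rewrite integral_mkcond; apply: eq_integral => s _; rewrite !patchE.
  congr (if _ then _ else _); apply/idP/idP; rewrite !inE/= !in_itv/= => /andP[? ?];
  by apply/andP; split; lra.
- by apply/(measurable_restrictT _ mI); exact/measurable_EFinP.
- by move=> s; apply: erestrict_ge0 => ? _; rewrite lee_fin.
Qed.

Lemma jointly_measurableS (t T : R) (f : R -> Omega -> R) : t <= T ->
  jointly_measurable T f -> jointly_measurable t f.
Proof.
move=> tT; apply: measurable_funS.
  by apply: measurableX => //; exact: measurable_itv.
by move=> [s w] [/=]; rewrite !in_itv/= => /andP[-> /le_trans ->].
Qed.

Lemma jointly_measurable_mxS (t T : R) (m n : nat) (f : R -> Omega -> 'M[R]_(m, n)) :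
  t <= T ->
  measurable_mx (I T `*` [set: Omega]) (fun p : measurableTypeR R * Omega => f p.1 p.2) ->
  measurable_mx (I t `*` [set: Omega]) (fun p : measurableTypeR R * Omega => f p.1 p.2).
Proof.
move=> tT; apply: measurable_mxS.
  by apply: measurableX => //; exact: measurable_itv.
by move=> [s w] [/=]; rewrite !in_itv/= => /andP[-> /le_trans ->].
Qed.

Lemma jointly_measurable_kernel (t T : R) (g : R -> R) : t <= T ->
  measurable_fun (I T) g -> jointly_measurable t (fun s (_ : Omega) => g (t - s)).
Proof.
move=> tT mg.
apply: (@measurable_comp _ _ _ _ _ _ (I T) g (I t `*` [set: Omega])
  (fun p : measurableTypeR R * Omega => (t - p.1 : measurableTypeR R))) => //.
- by move=> _ [[s w] /= [+ _] <-]; rewrite !in_itv/= => /andP[? ?]; apply/andP; split; lra.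
- by apply: measurable_funTS; apply: measurable_funB => //; exact: measurable_fst.
Qed.

Variable P : probability Omega R.

(** Tonelli isolates the expectation of [Z], and the reflection [s -> t - s] turns the convolution
    into a plain integral of [g]: this is how the integral of the kernel error appears in the final
    bound. *)
Lemma time_integral_weight (t T S : R) (g : R -> R) (Z : R -> Omega -> R) :
  t <= T -> measurable_fun (I T) g -> (forall s, 0 <= g s) ->
  jointly_measurable T Z -> (forall s w, 0 <= Z s w) -> 0 <= S ->
  (forall s, 0 <= s <= t -> (\int[P]_w (Z s w)%:E <= S%:E)%E) ->
  (time_integral P t (fun s w => (g (t - s) * Z s w)%R) <=
     S%:E * \int[mu]_(s in I t) (g s)%:E)%E.
Proof.
move=> tT mg g0 mZ Z0 S0 ZS.
have mZt := jointly_measurableS tT mZ.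
have mgt : jointly_measurable t (fun s (_ : Omega) => g (t - s)) by exact: jointly_measurable_kernel mg.
have mI : measurable (I t) by exact: measurable_itv.
have mgI : measurable_fun (I t) g.
  apply: measurable_funS mg; first exact: measurable_itv.
  by move=> s /=; rewrite !in_itv/= => /andP[-> /le_trans ->].
have mgr : measurable_fun (I t) (fun s => (g (t - s))%:E).
  exact: (jointly_measurable_section point mgt).
have mEZ : measurable_fun (I t) (fun s => \int[P]_w (Z s w)%:E)%E.
  by apply/(measurable_restrictT _ mI); exact: measurable_expectation.
rewrite time_integral_swap; last 2 first.
- exact: measurable_funM.
- by move=> s w; rewrite mulr_ge0.
rewrite -integral_reflect_itv// -ge0_integralZl//; last by move=> s _; rewrite lee_fin.
have innerE s : s \in I t -> (\int[P]_w (g (t - s) * Z s w)%:E =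
    (g (t - s))%:E * \int[P]_w (Z s w)%:E)%E.
  rewrite inE => sI; rewrite -ge0_integralZl//.
  - apply/measurable_EFinP.
    apply: (@measurable_comp _ _ _ _ _ _ (I t `*` [set: Omega])
      (fun p : measurableTypeR R * Omega => Z p.1 p.2) setT (fun w => (s, w))) => //.
    + exact: measurableX.
    + by move=> _ [w _ <-].
    + exact: measurable_pair1.
  - by move=> w _; rewrite lee_fin.
  - by rewrite lee_fin.
apply: (@le_trans _ _
    (\int[mu]_(s in I t) ((g (t - s))%:E * \int[P]_w (Z s w)%:E))%E).
  by rewrite le_eqVlt; apply/orP; left; apply/eqP; exact: eq_integral.
apply: ge0_le_integral => //.
- move=> s _; rewrite mule_ge0 ?lee_fin//.
  by apply: integral_ge0 => w _; rewrite lee_fin.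
- exact: emeasurable_funM.
- exact: measurable_funeM.
- move=> s /=; rewrite in_itv/= => st; rewrite muleC lee_wpmul2r ?lee_fin//.
  exact: ZS.
Qed.

End time_changes.

(** * Gronwall's lemma for expectations of processes *)

Section second_moment_gronwall.
Local Open Scope ereal_scope.
Context {R : realType}.
Local Notation mu := (@lebesgue_measure R).
Variables (k : R -> R) (T : R).
Hypotheses (k_ge0 : forall s, (0 <= k s)%R)
  (k_supp : forall s, (s <= 0)%R -> k s = 0%R)
  (k_int : mu.-integrable [set: measurableTypeR R] (EFin \o k)).

(** [C] precedes the probability space and the process, hence is uniform in [K]. The horizon [t0] is
    free so that [A] may depend on it. *)
Lemma second_moment_gronwall (c : R) : (0 <= c)%R ->
  exists C : R, (0 < C)%R /\
  forall (dO : measure_display) (Omega : measurableType dO) (P : probability Omega R)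
    (Z : R -> Omega -> R) (A t0 : R),
  jointly_measurable T Z -> (forall s w, 0 <= Z s w)%R ->
  time_integral P T Z < +oo -> (0 <= A)%R -> (0 <= t0 <= T)%R ->
  (forall t, (0 <= t <= t0)%R -> \int[P]_w (Z t w)%:E <=
     A%:E + c%:E * time_integral P t (fun s w => (k (t - s) * Z s w)%R)) ->
  forall t, (0 <= t <= t0)%R -> \int[P]_w (Z t w)%:E <= (C * A)%:E.
Proof.
move=> c0.
have mk : measurable_fun [set: measurableTypeR R] k.
  by apply/measurable_EFinP; exact: measurable_int k_int.
have ck_ge0 s : (0 <= c * k s)%R by rewrite mulr_ge0.
have ck_supp s : (s <= 0)%R -> (c * k s = 0)%R by move=> /k_supp ->; rewrite mulr0.
have ck_int : mu.-integrable [set: measurableTypeR R] (EFin \o (fun s => c * k s)%R).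
  exact: integrable_mull.
have [C [C0 HC]] := convolution_gronwall ck_ge0 ck_supp ck_int T.
exists C; split => // dO Omega P Z A t0 mZ Z0 Z_int A0 /andP[t0_ge0 t0T] Z_le.
pose I (t : R) : set (measurableTypeR R) := `[0%R, t]%classic.
have mI t : measurable (I t) by exact: measurable_itv.
pose f := (fun s : measurableTypeR R => \int[P]_w (Z s w)%:E) \_ (I T).
have EZ_ge0 s : 0 <= \int[P]_w (Z s w)%:E.
  by apply: integral_ge0 => w _; rewrite lee_fin.
have fE s : (0 <= s <= T)%R -> f s = \int[P]_w (Z s w)%:E.
  by move=> sT; rewrite /f patchE ifT// inE /I/= in_itv.
have f_ge0 s : 0 <= f s by apply: erestrict_ge0.
have mf : measurable_fun [set: measurableTypeR R] f by exact: measurable_expectation.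
move=> t /andP[t_ge0 tt0]; rewrite -fE ?t_ge0 ?(le_trans tt0)//.
apply: (HC f A t0) => //; first by rewrite t0_ge0.
- apply: le_lt_trans Z_int; rewrite time_integral_swap//.
  apply: (@le_trans _ _ (\int[mu]_(s in I T) f s)).
    apply: ge0_subset_integral => //; try exact: mI.
    + exact: measurable_funTS.
    + by move=> s; rewrite /I/= !in_itv/= => /andP[-> /le_trans ->].
  rewrite le_eqVlt; apply/orP; left; apply/eqP; apply: eq_integral => s.
  by rewrite inE /I/= in_itv/= => sT; rewrite fE.
- move=> u /andP[u0 ut0]; have uT := le_trans ut0 t0T.
  rewrite fE ?u0//; apply: (le_trans (Z_le u _)); first by rewrite u0.
  rewrite leeD2l//.
  have mZu := jointly_measurableS uT mZ.
  have mku : jointly_measurable u (fun s (_ : Omega) => k (u - s)).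
    by apply: (jointly_measurable_kernel uT); exact: measurable_funTS.
  have mkr : measurable_fun (I u) (fun s => (k (u - s))%:E).
    exact: (jointly_measurable_section point mku).
  have mfI : measurable_fun (I u) f by exact: measurable_funTS.
  rewrite time_integral_swap; last 2 first.
  + exact: measurable_funM.
  + by move=> s w; rewrite mulr_ge0.
  have innerE s : s \in I u -> \int[P]_w (k (u - s) * Z s w)%:E =
      (k (u - s))%:E * f s.
    rewrite inE => sI; rewrite fE; last first.
      by move: sI; rewrite /I/= in_itv/= => /andP[-> /le_trans ->].
    rewrite -ge0_integralZl//.
    * apply/measurable_EFinP.
      apply: (@measurable_comp _ _ _ _ _ _ (I u `*` [set: Omega])
        (fun p : measurableTypeR R * Omega => Z p.1 p.2) setT (fun w => (s, w))) => //.
      - exact: measurableX.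
      - by move=> _ [w _ <-].
      - exact: measurable_pair1.
    * by move=> w _; rewrite lee_fin.
    * by rewrite lee_fin.
  under eq_integral => s sI do rewrite (innerE s sI).
  rewrite -ge0_integralZl//.
  + rewrite le_eqVlt; apply/orP; left; apply/eqP; apply: eq_integral => s _.
    by rewrite muleA -EFinM.
  + exact: emeasurable_funM.
  + by move=> s _; rewrite mule_ge0// lee_fin.
- by rewrite t_ge0.
Qed.

End second_moment_gronwall.

(** * Differences of solutions of Volterra equations *)

Section volterra.
Context {R : realType} {d : nat} {dO : measure_display} {Omega : measurableType dO}.
Variables (P : probability Omega R) (F : R -> set (set Omega)).
Variable W : R -> Omega -> 'cV[R]_d.
Hypotheses (hF : filtration F) (hW : brownian_motion P F W).
Variables (T L : R) (x0 : 'cV[R]_d).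
Variables (b : 'cV[R]_d -> 'cV[R]_d) (sigma : 'cV[R]_d -> 'M[R]_d).
Hypotheses (T_gt0 : 0 < T) (lip : lipschitz_coeffs L b sigma).
Local Notation mu := (@lebesgue_measure R).
Local Notation c2 := (@gaussian_second_moment R).
Local Notation I t := (`[0%R, t]%classic : set (measurableTypeR R)).

Lemma volterra_solution_measurable G1 G2 X :
  volterra_solution P F W T x0 b sigma G1 G2 X ->
  measurable_mx (I T `*` [set: Omega]) (fun p : measurableTypeR R * Omega => X p.1 p.2).
Proof. by case=> mX _ _ _ i j; rewrite (ord1 j). Qed.

Lemma volterra_solution_measurable_at G1 G2 X t : 0 <= t <= T ->
  volterra_solution P F W T x0 b sigma G1 G2 X -> measurable_mx setT (X t).
Proof.
move=> tT [_ /(_ t tT) mX _ _] i j; have /andP[t0 _] := tT.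
by apply: (measurable_for_measurable hF t0) => B mB; exact: mX.
Qed.

Lemma measurable_convolution_integrand (m : nat) (G : R -> 'M[R]_d)
    (g : 'cV[R]_d -> 'M[R]_(d, m)) (X : R -> Omega -> 'cV[R]_d) t :
  t <= T -> kernel_measurable T G ->
  (forall x y, frob (g x - g y) <= L * frob (x - y)) ->
  measurable_mx (I T `*` [set: Omega]) (fun p : measurableTypeR R * Omega => X p.1 p.2) ->
  measurable_mx (I t `*` [set: Omega])
    (fun p : measurableTypeR R * Omega => G (t - p.1) *m g (X p.1 p.2)).
Proof.
move=> tT mG gL mX; apply: measurable_mxM.
  move=> i j.
  exact: (jointly_measurable_kernel (Omega := Omega) (g := fun s => G s i j) tT (mG i j)).
apply: (measurable_mx_lipschitz_comp _ gL).
  by apply: measurableX => //; exact: measurable_itv.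
exact: jointly_measurable_mxS mX.
Qed.

(** The initial value cancels. In the constant, 2 separates drift from martingale part, [T] is the
    Cauchy-Schwarz factor of the drift, and 18 is 2 times the 9 of [is_ito_difference]. *)
Lemma volterra_difference G1 G2 G1' G2' X X' t :
  kernel_measurable T G1 -> kernel_measurable T G2 ->
  kernel_measurable T G1' -> kernel_measurable T G2' ->
  volterra_solution P F W T x0 b sigma G1 G2 X ->
  volterra_solution P F W T x0 b sigma G1' G2' X' ->
  0 <= t <= T ->
  (\int[P]_w (frob (X' t w - X t w) ^+ 2)%:E <=
   (2 * T + 18 * c2)%:E * time_integral P t (fun s w =>
     (frob (G1' (t - s) *m b (X' s w) - G1 (t - s) *m b (X s w)) ^+ 2 +
      frob (G2' (t - s) *m sigma (X' s w) - G2 (t - s) *m sigma (X s w)) ^+ 2)%R))%E.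
Proof.
move=> mG1 mG2 mG1' mG2' sX sX' tT; have /andP[t0 tleT] := tT.
have mX := volterra_solution_measurable sX.
have mX' := volterra_solution_measurable sX'.
have mXt := volterra_solution_measurable_at tT sX.
have mXt' := volterra_solution_measurable_at tT sX'.
have bL := lipschitz_drift lip; have sL := lipschitz_diffusion lip.
have m1 := measurable_convolution_integrand tleT mG1 bL mX.
have m1' := measurable_convolution_integrand tleT mG1' bL mX'.
have m2 := measurable_convolution_integrand tleT mG2 sL mX.
have m2' := measurable_convolution_integrand tleT mG2' sL mX'.
case: sX => _ _ _ /(_ t tT)[Y [itoY XE]].
case: sX' => _ _ _ /(_ t tT)[Y' [itoY' XE']].
have mY : measurable_mx setT Y by move=> i j _ B mB; rewrite setTI; case: itoY => + _; exact.
have mY' : measurable_mx setT Y' by move=> i j _ B mB; rewrite setTI; case: itoY' => + _; exact.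
have ito_le := is_ito_difference hF hW t0 itoY itoY' m2 m2'.
pose H1 s w := G1' (t - s) *m b (X' s w) - G1 (t - s) *m b (X s w).
pose H2 s w := G2' (t - s) *m sigma (X' s w) - G2 (t - s) *m sigma (X s w).
have mH1 : measurable_mx (I t `*` [set: Omega]) (fun p : measurableTypeR R * Omega => H1 p.1 p.2).
  exact: measurable_mxB.
have mH2 : measurable_mx (I t `*` [set: Omega]) (fun p : measurableTypeR R * Omega => H2 p.1 p.2).
  exact: measurable_mxB.
have j1 : jointly_measurable t (fun s w => frob (H1 s w) ^+ 2) by exact: measurable_frob_sqr.
have j2 : jointly_measurable t (fun s w => frob (H2 s w) ^+ 2) by exact: measurable_frob_sqr.
have sq0 m n (A : 'M[R]_(m, n)) : 0 <= frob A ^+ 2 by exact: sqr_ge0.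
have c20 := @gaussian_second_moment_ge0 R.
have mI : measurable (I t) by exact: measurable_itv.
have colE (v : 'cV[R]_d) : frob v ^+ 2 = \sum_i v i 0 ^+ 2.
  by rewrite frob_sqr; apply: eq_bigr => i _; rewrite big_ord1.
have drift_le w : (forall i, mu.-integrable (I t) (EFin \o (fun s => H1 s w i 0))) ->
    ((frob (\col_i Rintegral mu (I t) (fun s => H1 s w i 0)) ^+ 2)%:E <=
     T%:E * \int[mu]_(s in I t) (frob (H1 s w) ^+ 2)%:E)%E.
  move=> iH.
  under eq_integral do rewrite colE -sumEFin.
  rewrite ge0_integral_sum//; last 2 first.
  - move=> i; have := @measurable_int _ _ _ _ _ _ (iH i) => /measurable_EFinP mHi.
    by apply/measurable_EFinP; exact: measurable_funX.
  - by move=> i s _; rewrite lee_fin sqr_ge0.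
  rewrite ge0_sume_distrr; last first.
    by move=> i _; apply: integral_ge0 => s _; rewrite lee_fin sqr_ge0.
  rewrite colE -sumEFin; apply: lee_sum => i _; rewrite mxE.
  apply: Rintegral_sqr_le => //.
  by rewrite /= lebesgue_measure_itv/= lte_fin; case: ifPn => _;
    rewrite ?oppr0 ?adde0 lee_fin// ltW.
apply: (@le_trans _ _ (\int[P]_w ((2 * T)%:E * \int[mu]_(s in I t) (frob (H1 s w) ^+ 2)%:E
    + 2%:E * (frob (Y' w - Y w) ^+ 2)%:E))%E).
  apply: ae_ge0_le_integral => //.
  - by move=> w _; rewrite lee_fin.
  - by apply/measurable_EFinP/measurable_frob_sqr/measurable_mxB.
  - move=> w _; apply: adde_ge0; apply: mule_ge0; rewrite ?lee_fin ?sqr_ge0//.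
      by rewrite mulr_ge0// ltW.
    by apply: integral_ge0 => s _; rewrite lee_fin.
  - apply: emeasurable_funD; apply: measurable_funeM; first exact: measurable_time_integral.
    by apply/measurable_EFinP/measurable_frob_sqr/measurable_mxB.
  - apply: filterS2 XE XE' => w Xw Xw' _.
    have iH i : mu.-integrable (I t) (EFin \o (fun s => H1 s w i 0)).
      have [i1 _] := Xw i; have [i1' _] := Xw' i.
      have := integrableB mI i1' i1; apply: eq_integrable => // s _ /=.
      by rewrite -EFinB /H1 !mxE.
    have XtE : X' t w - X t w =
        \col_i Rintegral mu (I t) (fun s => H1 s w i 0) + (Y' w - Y w).
      apply/colP => i; have [i1 E1] := Xw i; have [i1' E1'] := Xw' i.
      rewrite !mxE E1 E1' (_ : Rintegral mu (I t) (fun s => H1 s w i 0) =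
        Rintegral mu (I t) (fun s => (G1' (t - s) *m b (X' s w)) i 0) -
        Rintegral mu (I t) (fun s => (G1 (t - s) *m b (X s w)) i 0)); first by ring.
      by rewrite -RintegralB//; apply: eq_Rintegral => s _; rewrite /H1 !mxE.
    rewrite XtE.
    apply: (@le_trans _ _ (2 * (frob (\col_i Rintegral mu (I t) (fun s => H1 s w i 0)) ^+ 2
      + frob (Y' w - Y w) ^+ 2))%:E); first by rewrite lee_fin frob_sqr_trD.
    rewrite mulrDr EFinD [in X in (_ <= _ + X)%E]EFinM leeD2r//.
    by rewrite EFinM [in leRHS]EFinM -muleA lee_wpmul2l// drift_le.
rewrite ge0_integralD//; last 4 first.
- move=> w _; rewrite mule_ge0// ?lee_fin ?mulr_ge0 ?(ltW T_gt0)//.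
  by apply: integral_ge0 => s _; rewrite lee_fin.
- by apply: measurable_funeM; exact: measurable_time_integral.
- by move=> w _; rewrite mule_ge0// lee_fin.
- by apply: measurable_funeM; apply/measurable_EFinP/measurable_frob_sqr/measurable_mxB.
rewrite ge0_integralZl//; last 3 first.
- exact: measurable_time_integral.
- by move=> w _; apply: integral_ge0 => s _; rewrite lee_fin.
- by rewrite lee_fin mulr_ge0// ltW.
rewrite ge0_integralZl//; last 2 first.
- by apply/measurable_EFinP/measurable_frob_sqr/measurable_mxB.
- by move=> w _; rewrite lee_fin.
rewrite time_integralD//.
pose A := time_integral P t (fun s w => (frob (H1 s w) ^+ 2)%R).
pose B := time_integral P t (fun s w => (frob (H2 s w) ^+ 2)%R).
have A0 : (0 <= A)%E by exact: time_integral_ge0.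
have B0 : (0 <= B)%E by exact: time_integral_ge0.
apply: (@le_trans _ _ ((2 * T + 18 * c2)%:E * (A + B))%E); last exact: lexx.
rewrite (ge0_muleDr _ A0 B0); apply: leeD.
  by apply: (lee_wpmul2r A0); rewrite lee_fin; lra.
apply: (le_trans (lee_wpmul2l _ ito_le)); first by [].
rewrite muleA -EFinM lee_wpmul2r// lee_fin.
by have := ltW T_gt0; lra.
Qed.

Lemma constant_volterra_solution :
  volterra_solution P F W T x0 b sigma (fun=> 0) (fun=> 0) (fun _ _ => x0).
Proof.
have cst_wrt t : 0 <= t -> forall (m n : nat) (A : 'M[R]_(m, n)), measurable_wrt (F t) (fun=> A).
  move=> t0 m n A i j B mB; have [F0 FC _] := filtration_sigma hF t0.
  have [BA|BA] := pselect (B (A i j)).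
    rewrite (_ : _ @^-1` _ = setT `\` set0); first exact: FC.
    by apply/seteqP; split=> // w _; split.
  by rewrite (_ : _ @^-1` _ = set0)//; apply/seteqP; split.
split.
- by move=> i; exact: measurable_cst.
- by move=> t /andP[t0 _]; exact: cst_wrt.
- under eq_integral do rewrite integral_cst//.
  rewrite /= lebesgue_measure_itv/= lte_fin T_gt0 oppr0 adde0 -EFinM.
  by rewrite (integral_cst P measurableT (_%:E))/= probability_setT mule1 ltry.
- move=> t /andP[t0 tT]; exists (fun=> 0); split; last first.
    apply: aeW => w i; split.
      rewrite (_ : (fun s => _) = cst 0%E); first exact: integrable0.
      by apply/funext => s; rewrite mul0mx mxE.
    have -> : Rintegral mu (I t) (fun=> (0 *m b x0) i 0) = 0.
      by apply: Rintegral_eq0 => s; rewrite mul0mx mxE.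
    by rewrite mxE !addr0.
  split; first by case: hF => _ Fm _ i j B mB; apply: (Fm 0) => //; exact: (cst_wrt 0).
  (* Empty step processes approximate the zero integrand exactly. *)
  exists (fun=> StepProcess 0 (fun=> 0) (fun _ _ => 0)); split.
  + by move=> n; split.
  + rewrite (_ : (fun n => _) = cst 0%E); first exact: cvg_cst.
    apply/funext => n; rewrite integral0_eq// => w _.
    rewrite integral0_eq// => s _.
    by rewrite mul0mx /step_val big_ord0 subr0 frob0 expr0n.
  + rewrite unlock (_ : (fun n => _) = cst 0%E); first exact: cvg_cst.
    apply/funext => n; rewrite integral0_eq// => w _.
    by rewrite /step_integral big_ord0 subr0 frob0 expr0n.
Qed.

(** The a priori finiteness under which Gronwall's lemma applies to the squared difference. *)
Lemma solution_sqr_integrable G1 G2 G1' G2' X X' :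
  volterra_solution P F W T x0 b sigma G1 G2 X ->
  volterra_solution P F W T x0 b sigma G1' G2' X' ->
  (time_integral P T (fun s w => (frob (X' s w - X s w) ^+ 2)%R) < +oo)%E.
Proof.
move=> sX sX'.
have mX := volterra_solution_measurable sX.
have mX' := volterra_solution_measurable sX'.
case: sX => _ _ X2 _; case: sX' => _ _ X2' _.
have sq0 (A : 'cV[R]_d) : 0 <= frob A ^+ 2 by exact: sqr_ge0.
have j : jointly_measurable T (fun s w => frob (X s w) ^+ 2) by exact: measurable_frob_sqr.
have j' : jointly_measurable T (fun s w => frob (X' s w) ^+ 2) by exact: measurable_frob_sqr.
apply: (@le_lt_trans _ _ (time_integral P T
    (fun s w => (2 * (frob (X' s w) ^+ 2 + frob (X s w) ^+ 2))%R))).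
  apply: le_time_integral => //.
  - by apply: measurable_frob_sqr; exact: measurable_mxB.
  - by apply: measurable_funM => //; exact: measurable_funD.
  - by move=> s w _; exact: frob_sqrB.
  - by move=> s w; rewrite mulr_ge0// addr_ge0.
rewrite time_integralZ//; last 2 first.
- exact: measurable_funD.
- by move=> s w; rewrite addr_ge0.
rewrite time_integralD//; apply: lte_mul_pinfty => //; exact: lte_add_pinfty X2' X2.
Qed.

End volterra.

(** The norms [r0], [b0], [s0], [m1], [m2] are fixed before [C], and the data having these norms
    after it: this encodes that [C] depends on the data through these numbers, besides [L], [T] and
    the fixed [d], [lambda] and [Dbar]. *)
Theorem proposition3p2 (R : realType) (d : nat) (d_ge1 : (1 <= d)%N)
  (lambda : {measure set (measurableTypeR R) -> \bar R})
  (Gbar_fin : forall t : R, 0 < t -> (Gbar lambda t < +oo)%E)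
  (Gbar_L2 : forall S : R, 0 < S ->
     (\int[lebesgue_measure]_(t in `[0%R, S]) (Gbar lambda t ^+ 2) < +oo)%E)
  (T : R) (T_gt0 : 0 < T)
  (Dbar : R -> R)
  (Dbar_meas : measurable_fun (`[0, T] : set (measurableTypeR R)) Dbar)
  (Dbar_ge0 : forall t : R, 0 <= t <= T -> 0 <= Dbar t)
  (Dbar_L2 : (\int[lebesgue_measure]_(t in `[0%R, T]) (Dbar t ^+ 2)%:E < +oo)%E)
  (r0 b0 s0 L m1 m2 : R) (L_gt0 : 0 < L) :
  exists C : R, 0 < C /\
  forall (x0 : 'cV[R]_d) (b : 'cV[R]_d -> 'cV[R]_d) (sigma : 'cV[R]_d -> 'M[R]_d)
    (M1 M2 : R -> 'M[R]_d),
  frob x0 = r0 -> frob (b 0) = b0 -> frob (sigma 0) = s0 ->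
  lipschitz_coeffs L b sigma ->
  bounded_measurable M1 -> bounded_measurable M2 ->
  supnorm M1 = m1 -> supnorm M2 = m2 ->
  forall Ghat1 Ghat2 : R -> R -> 'M[R]_d,
  let G1 := truncated_kernel lambda M1 in
  let G2 := truncated_kernel lambda M2 in
  let D1 := fun K t : R => Ghat1 K t - G1 K t in
  let D2 := fun K t : R => Ghat2 K t - G2 K t in
  (forall K : R, 0 < K ->
     kernel_measurable T (Ghat1 K) /\ kernel_measurable T (Ghat2 K)) ->
  (forall K t : R, 0 < K -> 0 <= t <= T ->
     frob (D1 K t) <= Dbar t /\ frob (D2 K t) <= Dbar t) ->
  forall (dO : measure_display) (Omega : measurableType dO)
    (P : probability Omega R) (F : R -> set (set Omega))
    (W : R -> Omega -> 'cV[R]_d),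
  filtration F -> brownian_motion P F W ->
  forall X Xhat : R -> R -> Omega -> 'cV[R]_d,
  (forall K : R, 0 < K ->
     volterra_solution P F W T x0 b sigma (G1 K) (G2 K) (X K)) ->
  (forall K : R, 0 < K ->
     volterra_solution P F W T x0 b sigma (Ghat1 K) (Ghat2 K) (Xhat K)) ->
  forall K : R, 0 < K -> forall t : R, 0 <= t <= T ->
  ('E_P[(fun w => (frob (Xhat K t w - X K t w) ^+ 2)%R)] <=
   C%:E * \int[lebesgue_measure]_(s in `[0%R, t])
            (frob (D1 K s) ^+ 2 + frob (D2 K s) ^+ 2)%:E)%E.
Proof.
pose k0 := dominating_kernel lambda T Dbar.
have k0_ge0 : forall s, 0 <= k0 s by move=> s; exact: dominating_kernel_ge0.
have k0_supp : forall s, s <= 0 -> k0 s = 0 by move=> s; exact: dominating_kernel_supp.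
have k0_int : lebesgue_measure.-integrable [set: measurableTypeR R] (EFin \o k0).
  exact: (dominating_kernel_integrable Gbar_fin (Gbar_L2 T T_gt0)).
pose c2 := @gaussian_second_moment R.
have c2_ge0 : 0 <= c2 by exact: gaussian_second_moment_ge0.
pose C0 := 2 * T + 18 * c2.
have C0_ge0 : 0 <= C0 by rewrite /C0; have := ltW T_gt0; lra.
(* [cG k0] dominates both squared truncated kernels; [d * d] is the cost of passing from entries to
   the Frobenius norm. *)
pose cG := (d * d)%:R * (m1 ^+ 2 + m2 ^+ 2).
have cG_ge0 : 0 <= cG by rewrite mulr_ge0// addr_ge0 ?sqr_ge0.
(* Linear growth gives [|b x|^2 + |sigma x|^2 <= 2 (b0^2 + s0^2) + 4 L^2 |x|^2], and
   [|x|^2 <= 2 (|x - x0|^2 + r0^2)]. *)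
pose alpha := 2 * (b0 ^+ 2 + s0 ^+ 2) + 8 * L ^+ 2 * r0 ^+ 2.
pose beta := 8 * L ^+ 2.
have beta_ge0 : 0 <= beta by rewrite mulr_ge0// sqr_ge0.
have alpha_ge0 : 0 <= alpha.
  have := sqr_ge0 b0; have := sqr_ge0 s0.
  by have := mulr_ge0 (sqr_ge0 L) (sqr_ge0 r0); rewrite /alpha; lra.
(* From [|Ghat|^2 <= 2 |D|^2 + 2 |G|^2], with [|D|^2 <= Dbar^2 <= k0] on []0, T]]. *)
pose e1 := C0 * (2 + 2 * cG).
have cG2_ge0 : 0 <= 2 + 2 * cG by lra.
have e1_ge0 : 0 <= e1 by exact: mulr_ge0.
have [Cm [Cm_gt0 moment]] := second_moment_gronwall T k0_ge0 k0_supp k0_int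
  (mulr_ge0 e1_ge0 beta_ge0).
(* Drift and diffusion each contribute [2 cG L^2] to the term absorbed by Gronwall. *)
have e4_ge0 : 0 <= 4 * cG * L ^+ 2.
  by apply: mulr_ge0; [exact: mulr_ge0|exact: sqr_ge0].
have e2_ge0 := mulr_ge0 C0_ge0 e4_ge0.
have [Cd [Cd_gt0 difference]] := second_moment_gronwall T k0_ge0 k0_supp k0_int e2_ge0.
pose kappa := fine (\int[lebesgue_measure]_s (k0 s)%:E).
have kappaE : (\int[lebesgue_measure]_s (k0 s)%:E = kappa%:E)%E.
  by rewrite fineK//; exact: integrable_fin_num.
have kappa_ge0 : 0 <= kappa by apply/fine_ge0/integral_ge0 => s _; rewrite lee_fin.
(* The uniform bound on [E|Xhat_s - x0|^2]: the part [alpha] of the growth bound, convolved with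
   [k0], gives at most [alpha kappa]. *)
pose S := Cm * (e1 * alpha * kappa).
have S_ge0 : 0 <= S.
  exact: mulr_ge0 (ltW Cm_gt0) (mulr_ge0 (mulr_ge0 e1_ge0 alpha_ge0) kappa_ge0).
pose e3 := C0 * (2 * (alpha + beta * S)).
have alphaS_ge0 : 0 <= alpha + beta * S by exact: addr_ge0 alpha_ge0 (mulr_ge0 beta_ge0 S_ge0).
have e3_ge0 : 0 <= e3 by exact: mulr_ge0 C0_ge0 (mulr_ge0 (ler0n _ 2) alphaS_ge0).
(* The added 1 ensures positivity, as [e3] vanishes when [r0], [b0] and [s0] do. *)
exists (Cd * e3 + 1); split; first by exact: ltr_wpDl (mulr_ge0 (ltW Cd_gt0) e3_ge0) ltr01.
move=> x0 b sigma M1 M2 x0E b0E s0E lip bM1 bM2 m1E m2E Ghat1 Ghat2 G1 G2 D1 D2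
  mGhat DK dO Omega P F W hF hW X Xhat solX solXhat K K0 t tT.
have [mGh1 mGh2] := mGhat K K0.
have sX := solX K K0; have sXh := solXhat K K0.
have s0x := @constant_volterra_solution R d dO Omega P F W hF T x0 b sigma T_gt0.
have mG1 := truncated_kernel_measurable Gbar_fin bM1 K (T := T).
have mG2 := truncated_kernel_measurable Gbar_fin bM2 K (T := T).
have mzero : kernel_measurable T (fun=> 0 : 'M[R]_d).
  by move=> i j; exact: measurable_cst.
have mX := volterra_solution_measurable sX.
have mXh := volterra_solution_measurable sXh.
have sq0 m n (A : 'M[R]_(m, n)) : 0 <= frob A ^+ 2 by exact: sqr_ge0.
have mk0 : measurable_fun [set: measurableTypeR R] k0.
  by apply/measurable_EFinP; exact: measurable_int k0_int.
have mk0T : measurable_fun (`[0, T] : set (measurableTypeR R)) k0 by exact: measurable_funTS.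
pose Z s w := frob (Xhat K s w - x0) ^+ 2.
pose V s w := frob (Xhat K s w - X K s w) ^+ 2.
pose D s := frob (D1 K s) ^+ 2 + frob (D2 K s) ^+ 2.
have D_ge0 s : 0 <= D s by rewrite addr_ge0.
have Z_ge0 s w : 0 <= Z s w by exact: sq0.
have V_ge0 s w : 0 <= V s w by exact: sq0.
have jZ : jointly_measurable T Z.
  by apply: measurable_frob_sqr; apply: measurable_mxB => //; exact: measurable_mx_cst.
have jV : jointly_measurable T V by apply: measurable_frob_sqr; exact: measurable_mxB.
have mD : measurable_fun (`[0, T] : set (measurableTypeR R)) D.
  by apply: measurable_funD; apply: measurable_frob_sqr; apply: measurable_mxB.
have Z_int : (time_integral P T Z < +oo)%E by exact: solution_sqr_integrable s0x sXh.
have V_int : (time_integral P T V < +oo)%E by exact: solution_sqr_integrable sX sXh.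
have bL x y : frob (b x - b y) <= L * frob (x - y) by exact: lipschitz_drift lip x y.
have sL x y : frob (sigma x - sigma y) <= L * frob (x - y) by exact: lipschitz_diffusion lip x y.
have growth s w : frob (b (Xhat K s w)) ^+ 2 + frob (sigma (Xhat K s w)) ^+ 2 <=
    alpha + beta * Z s w.
  have h1 := linear_growth_sqr (bL (Xhat K s w) 0).
  have h2 := linear_growth_sqr (sL (Xhat K s w) 0).
  have h3 : frob (Xhat K s w) ^+ 2 <= 2 * (Z s w + r0 ^+ 2).
    by rewrite -x0E -[X in frob X ^+ 2](subrK x0); exact: frob_sqr_trD.
  have := ler_wpM2l (sqr_ge0 L) h3; rewrite b0E in h1; rewrite s0E in h2.
  by rewrite /alpha /beta; lra.
have G1_le u : 0 < u <= T -> frob (G1 K u) ^+ 2 <= cG * k0 u.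
  move=> uT; have /andP[u0 _] := uT.
  apply: (le_trans (truncated_kernel_sqr_le Gbar_fin bM1 K u0)).
  rewrite /k0 dominating_kernelE// m1E /cG -!mulrA ler_wpM2l//.
  have := mulr_ge0 (sqr_ge0 m1) (sqr_ge0 (Dbar u)).
  have := mulr_ge0 (sqr_ge0 m2) (sqr_ge0 (Dbar u)).
  by have := mulr_ge0 (sqr_ge0 m2) (sqr_ge0 (fine (Gbar lambda u))); lra.
have G2_le u : 0 < u <= T -> frob (G2 K u) ^+ 2 <= cG * k0 u.
  move=> uT; have /andP[u0 _] := uT.
  apply: (le_trans (truncated_kernel_sqr_le Gbar_fin bM2 K u0)).
  rewrite /k0 dominating_kernelE// m2E /cG -!mulrA ler_wpM2l//.
  have := mulr_ge0 (sqr_ge0 m1) (sqr_ge0 (Dbar u)).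
  have := mulr_ge0 (sqr_ge0 m2) (sqr_ge0 (Dbar u)).
  by have := mulr_ge0 (sqr_ge0 m1) (sqr_ge0 (fine (Gbar lambda u))); lra.
have D_le u : 0 <= u <= T ->
    frob (D1 K u) ^+ 2 <= Dbar u ^+ 2 /\ frob (D2 K u) ^+ 2 <= Dbar u ^+ 2.
  move=> uT; have [h1 h2] := DK K u K0 uT.
  by split; rewrite lerXn2r// ?nnegrE ?frob_ge0// Dbar_ge0.
have Ghat_le u : 0 < u <= T ->
    frob (Ghat1 K u) ^+ 2 <= (2 + 2 * cG) * k0 u /\
    frob (Ghat2 K u) ^+ 2 <= (2 + 2 * cG) * k0 u.
  move=> uT; have uT' : 0 <= u <= T by have /andP[/ltW -> ->] := uT.
  have [h1 h2] := D_le u uT'.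
  have k0D : Dbar u ^+ 2 <= k0 u by rewrite /k0 dominating_kernelE// lerDl sqr_ge0.
  have := G1_le u uT; have := G2_le u uT => g2 g1.
  have := frob_sqr_trD (D1 K u) (G1 K u); have := frob_sqr_trD (D2 K u) (G2 K u).
  by rewrite /D1 /D2 !subrK in h1 h2 * => f2 f1; split; lra.
have moment_bound s : 0 <= s <= T -> (\int[P]_w (Z s w)%:E <= S%:E)%E.
  apply: (moment _ _ P Z (e1 * alpha * kappa) T) => //.
  - exact: mulr_ge0 (mulr_ge0 e1_ge0 alpha_ge0) kappa_ge0.
  - by rewrite lexx ltW.
  move=> {s} s sT; have /andP[s_ge0 sleT] := sT.
  have jZs := jointly_measurableS sleT jZ.
  have k1_ge0 r (_ : Omega) : 0 <= k0 (s - r) * 1 by rewrite mulr1.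
  have kZ_ge0 r w : 0 <= k0 (s - r) * Z r w by exact: mulr_ge0.
  have ak_ge0 r (_ : Omega) : 0 <= alpha * (k0 (s - r) * 1) by rewrite mulr1; exact: mulr_ge0.
  have bk_ge0 r w : 0 <= beta * (k0 (s - r) * Z r w) by exact: mulr_ge0.
  have jk : jointly_measurable s (fun r (_ : Omega) => k0 (s - r)).
    exact: jointly_measurable_kernel mk0T.
  have /le_trans := volterra_difference hF hW T_gt0 lip mzero mzero mGh1 mGh2 s0x sXh sT.
  apply; rewrite -/c2 -/C0.
  (* The factor 1 presents the inhomogeneous term as a weighted constant process, the form that
     [time_integral_weight] bounds. *)
  apply: (@le_trans _ _ (C0%:E * time_integral P s (fun r w =>
      ((2 + 2 * cG) * (alpha * (k0 (s - r) * 1) + beta * (k0 (s - r) * Z r w)))%R))%E).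
    apply: lee_wpmul2l => //; apply: le_time_integral.
    - apply: measurable_funD; apply: measurable_frob_sqr; apply: measurable_mxB.
      + exact: measurable_convolution_integrand bL mXh.
      + exact: measurable_mx_cst.
      + exact: measurable_convolution_integrand sL mXh.
      + exact: measurable_mx_cst.
    - apply: measurable_funM => //; apply: measurable_funD; apply: measurable_funM => //.
        exact: measurable_funM.
      exact: measurable_funM.
    - by move=> r w; rewrite addr_ge0.
    - move=> r w /andP[r0' rs]; have uT : 0 < s - r <= T by apply/andP; split; lra.
      rewrite !mul0mx !subr0; have [g1 g2] := Ghat_le _ uT.
      have f1 := frob_sqrM (Ghat1 K (s - r)) (b (Xhat K r w)).
      have f2 := frob_sqrM (Ghat2 K (s - r)) (sigma (Xhat K r w)).
      have h1 := ler_wpM2r (sq0 _ _ (b (Xhat K r w))) g1.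
      have h2 := ler_wpM2r (sq0 _ _ (sigma (Xhat K r w))) g2.
      have q0 := mulr_ge0 cG2_ge0 (k0_ge0 (s - r)).
      have := ler_wpM2l q0 (growth r w).
      by rewrite mulrDr; lra.
    - by move=> r w; exact: mulr_ge0 cG2_ge0 (addr_ge0 (ak_ge0 r w) (bk_ge0 r w)).
  rewrite time_integralZ; last 3 first.
  - exact: cG2_ge0.
  - apply: measurable_funD; apply: measurable_funM => //; exact: measurable_funM.
  - by move=> r w; exact: addr_ge0 (ak_ge0 r w) (bk_ge0 r w).
  rewrite time_integralD; last 4 first.
  - apply: measurable_funM => //; exact: measurable_funM.
  - apply: measurable_funM => //; exact: measurable_funM.
  - by [].
  - by [].
  rewrite time_integralZ//; last exact: measurable_funM.
  rewrite time_integralZ//; last exact: measurable_funM.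
  set I1 := time_integral P s (fun r _ => (k0 (s - r) * 1)%R).
  set I2 := time_integral P s (fun r w => (k0 (s - r) * Z r w)%R).
  have I1_ge0 : (0 <= I1)%E by exact: time_integral_ge0.
  have I2_ge0 : (0 <= I2)%E by exact: time_integral_ge0.
  have I1_le : (I1 <= kappa%:E)%E.
    apply: (@le_trans _ _ (1%:E * \int[lebesgue_measure]_(r in `[0%R, s]) (k0 r)%:E)%E).
      apply: (@time_integral_weight R dO Omega P s T 1 k0 (fun _ _ => 1)) => //.
        exact: measurable_cst.
      move=> r _; rewrite (integral_cst P measurableT (1%:E))/=.
      by rewrite probability_setT mule1.
    rewrite mul1e -kappaE; apply: ge0_subset_integral => //.
    - exact/measurable_EFinP.
    - by move=> r _; rewrite lee_fin.
  rewrite muleA -EFinM -/e1 ge0_muleDr; [|by rewrite mule_ge0|by rewrite mule_ge0].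
  rewrite !muleA -!EFinM.
  apply: leeD => //; rewrite (EFinM _ kappa); apply: lee_wpmul2l => //.
  by rewrite lee_fin; exact: mulr_ge0.
(* The constant [A] of Gronwall's lemma is a real number, so the error integral has to be finite;
   [2 Dbar^2] dominates it. *)
have D_int : (\int[lebesgue_measure]_(s in `[0%R, t]) (D s)%:E)%E \is a fin_num.
  have /andP[t_ge0 tleT] := tT.
  have mDt : measurable_fun (`[0, t] : set (measurableTypeR R)) D.
    apply: measurable_funS mD; first exact: measurable_itv.
    by move=> s /=; rewrite !in_itv/= => /andP[-> /le_trans ->].
  have mDb2 : measurable_fun (`[0, T] : set (measurableTypeR R)) (fun s => (Dbar s ^+ 2)%:E).
    by apply/measurable_EFinP; exact: measurable_funX.
  rewrite ge0_fin_numE; last by apply: integral_ge0 => s _; rewrite lee_fin.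
  apply: (@le_lt_trans _ _ (\int[lebesgue_measure]_(s in `[0%R, T])
      (2%:E * (Dbar s ^+ 2)%:E))%E); last first.
    rewrite ge0_integralZl//; first by apply: lte_mul_pinfty.
    by move=> s _; rewrite lee_fin sqr_ge0.
  apply: (@le_trans _ _ (\int[lebesgue_measure]_(s in `[0%R, T]) (D s)%:E)%E).
    apply: ge0_subset_integral => //; try exact: measurable_itv.
    - exact/measurable_EFinP.
    - by move=> s _; rewrite lee_fin.
    - by move=> s /=; rewrite !in_itv/= => /andP[-> /le_trans ->].
  apply: ge0_le_integral => //.
  - by move=> s _; rewrite lee_fin.
  - exact/measurable_EFinP.
  - exact: measurable_funeM.
  - move=> s /=; rewrite in_itv/= => sT; rewrite -EFinM lee_fin.
    by have [h1 h2] := D_le s sT; rewrite /D; lra.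
pose ID := fine (\int[lebesgue_measure]_(s in `[0%R, t]) (D s)%:E)%E.
have ID_ge0 : 0 <= ID by apply/fine_ge0/integral_ge0 => s _; rewrite lee_fin.
have EID : ((\int[lebesgue_measure]_(s in `[0%R, t]) (D s)%:E) = ID%:E)%E by rewrite fineK.
rewrite -[X in (_ <= _ * X)%E]/(\int[lebesgue_measure]_(s in `[0%R, t]) (D s)%:E)%E EID.
rewrite unlock.
apply: (@le_trans _ _ (Cd * (e3 * ID))%:E); last first.
  by rewrite -EFinM lee_fin mulrDl mul1r mulrA lerDl.
(* Gronwall runs on [[0, t]] rather than [[0, T]], so that the constant [A] carries the error over
   [[0, t]] only. *)
apply: (difference _ _ P V (e3 * ID) t) => //; first exact: mulr_ge0; last first.
  by have /andP[-> _] := tT; rewrite lexx.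
move=> s /andP[s_ge0 st]; have /andP[_ tleT] := tT; have sleT := le_trans st tleT.
have sT : 0 <= s <= T by rewrite s_ge0.
have jVs := jointly_measurableS sleT jV; have jZs := jointly_measurableS sleT jZ.
have jk : jointly_measurable s (fun r (_ : Omega) => k0 (s - r)).
  exact: jointly_measurable_kernel mk0T.
have jD : jointly_measurable s (fun r (_ : Omega) => D (s - r)).
  exact: jointly_measurable_kernel mD.
have jg : jointly_measurable T (fun r w => alpha + beta * Z r w).
  by apply: measurable_funD => //; exact: measurable_funM.
have jgs := jointly_measurableS sleT jg.
have g_ge0 r w : 0 <= alpha + beta * Z r w by exact: addr_ge0 alpha_ge0 (mulr_ge0 beta_ge0 (Z_ge0 r w)).
have Dg_ge0 r w : 0 <= D (s - r) * (alpha + beta * Z r w) by exact: mulr_ge0.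
have kV_ge0 r w : 0 <= k0 (s - r) * V r w by exact: mulr_ge0.
have Dg2_ge0 r w : 0 <= 2 * (D (s - r) * (alpha + beta * Z r w)) by exact: mulr_ge0.
have kV4_ge0 r w : 0 <= 4 * cG * L ^+ 2 * (k0 (s - r) * V r w) by exact: mulr_ge0.
have /le_trans := volterra_difference hF hW T_gt0 lip mG1 mG2 mGh1 mGh2 sX sXh sT.
apply; rewrite -/c2 -/C0.
apply: (@le_trans _ _ (C0%:E * time_integral P s (fun r w =>
    (2 * (D (s - r) * (alpha + beta * Z r w)) +
     4 * cG * L ^+ 2 * (k0 (s - r) * V r w))%R))%E).
  apply: lee_wpmul2l => //; apply: le_time_integral.
  - apply: measurable_funD; apply: measurable_frob_sqr; apply: measurable_mxB.
    + exact: measurable_convolution_integrand bL mXh.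
    + exact: measurable_convolution_integrand bL mX.
    + exact: measurable_convolution_integrand sL mXh.
    + exact: measurable_convolution_integrand sL mX.
  - by apply: measurable_funD; apply: measurable_funM => //; exact: measurable_funM.
  - by move=> r w; rewrite addr_ge0.
  - move=> r w /andP[r0' rs]; have uT : 0 < s - r <= T by apply/andP; split; lra.
    set u := s - r in uT *; set x := X K r w; set xh := Xhat K r w.
    have split_le (m : nat) (g : 'cV[R]_d -> 'M[R]_(d, m)) (A B : 'M[R]_d) :
        frob (g xh - g x) <= L * frob (xh - x) -> frob B ^+ 2 <= cG * k0 u ->
        frob (A *m g xh - B *m g x) ^+ 2 <=
        2 * (frob (A - B) ^+ 2 * frob (g xh) ^+ 2) + 2 * (cG * L ^+ 2 * (k0 u * V r w)).
      move=> gL BG.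
      have -> : A *m g xh - B *m g x = (A - B) *m g xh + B *m (g xh - g x).
        by rewrite mulmxBl mulmxBr addrA subrK.
      have h1 := frob_sqr_trD ((A - B) *m g xh) (B *m (g xh - g x)).
      have h2 := frob_sqrM (A - B) (g xh).
      have h3 := frob_sqrM B (g xh - g x).
      have h4 := ler_pM (sq0 _ _ B) (sq0 _ _ (g xh - g x)) BG (lipschitz_sqr gL).
      by rewrite -/x -/xh -/(V r w) in h4; lra.
    have p1 := split_le _ b (Ghat1 K u) (G1 K u) (bL _ _) (G1_le u uT).
    have p2 := split_le _ sigma (Ghat2 K u) (G2 K u) (sL _ _) (G2_le u uT).
    (* Adding the two cross terms makes the error part a product of [D u] with the joint growth of
       [b] and [sigma]. *)
    have h1 := mulr_ge0 (sq0 _ _ (D1 K u)) (sq0 _ _ (sigma xh)).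
    have h2 := mulr_ge0 (sq0 _ _ (D2 K u)) (sq0 _ _ (b xh)).
    have h3 := ler_wpM2l (D_ge0 u) (growth r w).
    rewrite -/xh in h3; rewrite -/(D1 K u) in p1; rewrite -/(D2 K u) in p2.
    by rewrite {1}/D in h3; lra.
  - by move=> r w; exact: addr_ge0.
rewrite time_integralD; last 4 first.
- by apply: measurable_funM => //; exact: measurable_funM.
- by apply: measurable_funM => //; exact: measurable_funM.
- by [].
- by [].
rewrite time_integralZ//; last exact: measurable_funM.
rewrite time_integralZ; last 3 first.
- exact: e4_ge0.
- exact: measurable_funM.
- by [].
set J1 := time_integral P s (fun r w => (D (s - r) * (alpha + beta * Z r w))%R).
set J2 := time_integral P s (fun r w => (k0 (s - r) * V r w)%R).
have J1_ge0 : (0 <= J1)%E by exact: time_integral_ge0.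
have J2_ge0 : (0 <= J2)%E by exact: time_integral_ge0.
have J1_le : (J1 <= (alpha + beta * S)%:E * ID%:E)%E.
  apply: (@le_trans _ _ ((alpha + beta * S)%:E *
      \int[lebesgue_measure]_(r in `[0%R, s]) (D r)%:E)%E).
    apply: (@time_integral_weight R dO Omega P s T _ D) => //.
    move=> r /andP[r_ge0 rs].
    have rT : 0 <= r <= T by rewrite r_ge0 (le_trans rs).
    have mZr : measurable_fun setT (fun w => (Z r w)%:E).
      apply/measurable_EFinP/measurable_frob_sqr/measurable_mxB.
        exact: volterra_solution_measurable_at sXh.
      exact: measurable_mx_cst.
    under eq_integral do rewrite EFinD EFinM.
    rewrite ge0_integralD//; last 2 first.
    - by move=> w _; rewrite mule_ge0// lee_fin.
    - exact: measurable_funeM.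
    rewrite (integral_cst P measurableT (alpha%:E))/= probability_setT mule1.
    rewrite ge0_integralZl//; last by move=> w _; rewrite lee_fin.
    rewrite (EFinD alpha (beta * S)) (EFinM beta S); apply: leeD => //.
    by apply: lee_wpmul2l; [rewrite lee_fin|exact: moment_bound].
  rewrite -EID; apply: lee_wpmul2l; first by rewrite lee_fin.
  (* The error over [[0, s]] is enlarged to [[0, t]], to be constant in [s]. *)
  apply: ge0_subset_integral; try exact: measurable_itv.
  - apply/measurable_EFinP; apply: measurable_funS mD; first exact: measurable_itv.
    by move=> r /=; rewrite !in_itv/= => /andP[-> /le_trans ->].
  - by move=> r _; rewrite lee_fin.
  - by move=> r /=; rewrite !in_itv/= => /andP[-> /le_trans ->].
rewrite ge0_muleDr; last 2 first.
- by rewrite mule_ge0.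
- by rewrite mule_ge0// lee_fin.
rewrite !muleA -!EFinM; apply: leeD => //.
apply: (le_trans (lee_wpmul2l _ J1_le)); first by rewrite lee_fin; exact: mulr_ge0.
by rewrite muleA -!EFinM /e3 !mulrA.
Qed.
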